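(* Let $n\ge 2$ and $r>0$. For every function $u\in\mathscr S(\mathbb R^n)$ one has $$\lim_{s\to 1^-}\mathscr A^{(s)}_r u(x)=\mathscr M_r u(x)$$ for every $x\in\mathbb R^n$.
   Context: $\mathscr S(\mathbb R^n)$ is the Schwartz space. For $0<s<1$ and $r>0$ define $$A^{(s)}_r(y)=\begin{cases}c(n,s)\,\dfrac{r^{2s}}{(|y|^2-r^2)^s\,|y|^n}, & |y|>r,\\[2mm] 0, & |y|\le r,\end{cases}\qquad c(n,s)=\frac{\sin(\pi s)\,\Gamma\left(\frac n2\right)}{\pi^{\frac n2+1}},$$ and the nonlocal mean-value operator $\mathscr A^{(s)}_r u(x)=A^{(s)}_r\star u(x)=\int_{\mathbb R^n}A^{(s)}_r(y)\,u(x-y)\,dy$. The spherical mean-value operator is $$\mathscr M_r u(x)=\frac{1}{\sigma_{n-1}r^{n-1}}\int_{S(x,r)}u(y)\,d\sigma(y),$$ where $S(x,r)=\{y\in\mathbb R^n:|y-x|=r\}$, $d\sigma$ is its $(n-1)$-dimensional surface measure, and $\sigma_{n-1}=\frac{2\pi^{n/2}}{\Gamma(n/2)}$. *)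

(* Defs.v *)
From HB Require Import structures.
From mathcomp Require Import all_boot all_order all_algebra.
From mathcomp Require Import complex.
From mathcomp Require Import all_classical all_reals all_analysis.

Set Implicit Arguments.
Unset Strict Implicit.
Unset Printing Implicit Defensive.

Import Order.TTheory GRing.Theory Num.Theory.
Import numFieldNormedType.Exports.

Local Open Scope classical_set_scope.
Local Open Scope ring_scope.
Local Open Scope complex_scope.

Section tuple_cons_measure.
Context (R : realType) (n : nat).
Variable mu : {sigma_finite_measure set (n.-tuple (measurableTypeR R)) -> \bar R}.

Local Notation tuples m := (m.-tuple (measurableTypeR R)).
Local Notation prod_mu := (@lebesgue_measure R \x mu)%E.

Definition tuple_cons (p : measurableTypeR R * tuples n) : tuples n.+1 :=
  [the n.+1.-tuple _ of p.1 :: p.2].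

Definition tuple_uncons (t : tuples n.+1) : measurableTypeR R * tuples n :=
  (tnth t ord0, [tuple of behead t]).

Lemma measurable_tuple_cons : measurable_fun setT tuple_cons.
Proof. exact: measurable_cons. Qed.

Lemma measurable_tuple_uncons : measurable_fun setT tuple_uncons.
Proof.
apply: measurable_fun_pair; first exact: measurable_tnth.
exact: measurable_behead.
Qed.

Lemma tuple_consK : cancel tuple_cons tuple_uncons.
Proof. by case=> a t; congr pair; apply: val_inj. Qed.

Definition tuple_cons_measure : set (tuples n.+1) -> \bar R :=
  pushforward prod_mu tuple_cons.

Let tuple_cons_measure0 : tuple_cons_measure set0 = 0%E.
Proof. by rewrite /tuple_cons_measure /pushforward preimage_set0 measure0. Qed.

Let tuple_cons_measure_ge0 A : (0 <= tuple_cons_measure A)%E.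
Proof. by rewrite /tuple_cons_measure /pushforward measure_ge0. Qed.

Let tuple_cons_measure_sigma_additive : semi_sigma_additive tuple_cons_measure.
Proof.
exact: (@measure_semi_sigma_additive _ _ _
  (measure_function_pushforward__canonical__measure_function_Measure
    prod_mu measurable_tuple_cons)).
Qed.

HB.instance Definition _ := isMeasure.Build _ _ _ tuple_cons_measure
  tuple_cons_measure0 tuple_cons_measure_ge0 tuple_cons_measure_sigma_additive.

Let tuple_cons_measure_sigma_finite : sigma_finite setT tuple_cons_measure.
Proof.
have /sigma_finiteP[F [FT ndF Foo]] := sigma_finiteT (@lebesgue_measure R).
have /sigma_finiteP[G [GT ndG Goo]] := sigma_finiteT mu.
exists (fun k => tuple_uncons @^-1` (F k `*` G k)).
  rewrite -preimage_bigcup (_ : \bigcup_k (F k `*` G k) = setT) ?preimage_setT//.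
  rewrite -setXTT FT GT predeqE => -[x y]; split=> [[k _ []/= ? ?]|].
    by split; exists k.
  move=> [/= [k _ Fkx] [l _ Gly]]; exists (maxn k l) => //; split.
  - by move: x Fkx; exact/subsetPset/ndF/leq_maxl.
  - by move: y Gly; exact/subsetPset/ndG/leq_maxr.
move=> k; have [mF Fk] := Foo k; have [mG Gk] := Goo k; split.
  rewrite -[X in measurable X]setTI; apply: measurable_tuple_uncons => //.
  exact: measurableX.
rewrite /tuple_cons_measure /pushforward -comp_preimage.
rewrite (_ : tuple_uncons \o tuple_cons = id); last first.
  by apply/funext => p /=; rewrite tuple_consK.
by rewrite preimage_id product_measure1E// lte_mul_pinfty// ge0_fin_numE.
Qed.

HB.instance Definition _ := Measure_isSigmaFinite.Build _ _ _ tuple_cons_measure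
  tuple_cons_measure_sigma_finite.

End tuple_cons_measure.

(* The n-fold product of the Lebesgue measure of R. *)
Fixpoint lebesgue_tuple (R : realType) (n : nat) :
    {sigma_finite_measure set (n.-tuple (measurableTypeR R)) -> \bar R} :=
  match n with
  | 0 => \d_([tuple] : 0.-tuple (measurableTypeR R))
  | m.+1 => tuple_cons_measure (lebesgue_tuple R m)
  end.

(* Row vectors carry the normed-space structure (for derivatives) and tuples
   the measurable structure, so integrals over R^n go through [row_of_tuple]. *)
Definition row_of_tuple (R : realType) (n : nat) (t : n.-tuple (measurableTypeR R))
  : 'rV[R]_n := \row_i tnth t i.

(* Lebesgue integral over D of a complex-valued function. *)
Definition integral_rV (R : realType) (n : nat) (D : set 'rV[R]_n)
    (f : 'rV[R]_n -> R[i]) : R[i] :=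
  let E := @row_of_tuple R n @^-1` D in
  (\int[lebesgue_tuple R n]_(t in E) complex.Re (f (row_of_tuple t))) +i*
  (\int[lebesgue_tuple R n]_(t in E) complex.Im (f (row_of_tuple t))).

(* The norm `|x| that MathComp-Analysis puts on 'rV_n is the sup norm. *)
Definition enorm (R : realType) (n : nat) (x : 'rV[R]_n) : R :=
  Num.sqrt (\sum_i x 0 i ^+ 2).

Definition partial (R : realType) (n : nat) (i : 'I_n) (f : 'rV[R]_n -> R)
  : 'rV[R]_n -> R := fun x => 'D_(delta_mx 0 i) f x.

Definition iter_partial (R : realType) (n : nat) (l : seq 'I_n)
    (f : 'rV[R]_n -> R) : 'rV[R]_n -> R :=
  foldr (@partial R n) f l.

(* Smoothness is existence and continuity of all iterated partial derivatives;
   the multi-index of derivation is given as a list of coordinates. *)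
Definition schwartz_real (R : realType) (n : nat) (f : 'rV[R]_n -> R) : Prop :=
  forall l : seq 'I_n,
    [/\ continuous (iter_partial l f),
        forall (i : 'I_n) (x : 'rV[R]_n),
          derivable (iter_partial l f) x (delta_mx 0 i)
      & forall a : 'I_n -> nat, exists C : R, forall x : 'rV[R]_n,
          `|(\prod_i x 0 i ^+ a i) * iter_partial l f x| <= C].

(* R[i] has no R-normed structure, hence the split into real and imaginary
   parts. *)
Definition schwartz (R : realType) (n : nat) (u : 'rV[R]_n -> R[i]) : Prop :=
  schwartz_real (fun x => complex.Re (u x)) /\
  schwartz_real (fun x => complex.Im (u x)).

(* Euler's Gamma function at t > 0. *)
Definition Gamma (R : realType) (t : R) : R :=
  \int[@lebesgue_measure R]_(x in `]0, +oo[) (x `^ (t - 1) * expR (- x)).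

Definition c_ns (R : realType) (n : nat) (s : R) : R :=
  sin (pi * s) * Gamma (n%:R / 2) / pi `^ (n%:R / 2 + 1).

Definition A_kernel (R : realType) (n : nat) (s r : R) (y : 'rV[R]_n) : R :=
  if r < enorm y then
    c_ns n s * (r `^ (2 * s) / ((enorm y ^+ 2 - r ^+ 2) `^ s * enorm y ^+ n))
  else 0.

Definition nonlocal_mean (R : realType) (n : nat) (s r : R)
    (u : 'rV[R]_n -> R[i]) (x : 'rV[R]_n) : R[i] :=
  integral_rV setT (fun y => (A_kernel s r y)%:C * u (x - y)).

(* Gram density of a parametrisation Phi of a hypersurface. *)
Definition area_density (R : realType) (n : nat)
    (Phi : 'rV[R]_n.-1 -> 'rV[R]_n) (y : 'rV[R]_n.-1) : R :=
  Num.sqrt (\det (\matrix_(i < n.-1, j < n.-1)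
    \sum_(k < n) partial i (fun z => Phi z 0 k) y *
                 partial j (fun z => Phi z 0 k) y)).

(* Integral of f against the surface measure of the hypersurface Phi(D),
   Phi being injective on D. *)
Definition surface_integral (R : realType) (n : nat) (D : set 'rV[R]_n.-1)
    (Phi : 'rV[R]_n.-1 -> 'rV[R]_n) (f : 'rV[R]_n -> R[i]) : R[i] :=
  integral_rV D (fun y => f (Phi y) * (area_density Phi y)%:C).

(* (y, t), for n > 0 *)
Definition row_snoc (R : realType) (n : nat) (y : 'rV[R]_n.-1) (t : R)
  : 'rV[R]_n :=
  \row_(j < n) if insub (nat_of_ord j) is Some k then y 0 k else t.

(* S(x,r) is the union of two open hemispheres, graphs over the open ball of
   radius r in R^(n-1), and of the equator, which has surface measure 0. *)
Definition hemisphere (R : realType) (n : nat) (x : 'rV[R]_n) (r sgn : R)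
    (y : 'rV[R]_n.-1) : 'rV[R]_n :=
  x + row_snoc y (sgn * Num.sqrt (r ^+ 2 - enorm y ^+ 2)).

Definition sphere_integral (R : realType) (n : nat) (x : 'rV[R]_n) (r : R)
    (f : 'rV[R]_n -> R[i]) : R[i] :=
  let B := [set y : 'rV[R]_n.-1 | enorm y < r] in
  surface_integral B (hemisphere x r 1) f +
  surface_integral B (hemisphere x r (-1)) f.

(* sigma_(n-1), the area of the unit sphere of R^n *)
Definition sphere_area (R : realType) (n : nat) : R :=
  2 * pi `^ (n%:R / 2) / Gamma (n%:R / 2).

Definition spherical_mean (R : realType) (n : nat) (r : R)
    (u : 'rV[R]_n -> R[i]) (x : 'rV[R]_n) : R[i] :=
  ((sphere_area R n * r ^+ n.-1)^-1)%:C * sphere_integral x r u.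

(* Main.v *)
(** Writing [r * l] for the distance to the origin, with [l ^ 2 = 1 + w ^ p] and
    [p = 1 / (1 - s)], polar coordinates turn the singular weight
    [(|y|^2 - r^2)^(-s) d|y|] into [dw], so that
    [A_r^(s) u (x) = K(s) * int_0^oo h(l) / (1 + w^p) dw], where [h(l)] integrates
    [u] over the sphere of radius [r * l] and [K(s)] is explicit.  As [s -> 1-]
    we have [p -> +oo]: dominated convergence gives the limit [h(1)], and
    [sin(pi s) / (1 - s) -> pi] gives the limit of [K(s)].  Each sphere is cut into
    two hemispheres, graphs over the ball of radius [r] after scaling, so that the
    polar formula follows from Fubini, a one-dimensional substitution and a
    scaling; the integrability of the area density is read off the polar formula
    applied to a compactly supported function.  Neither the value of Gamma(n/2)
    nor the area of the sphere is needed. *)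

Require Import Defs.
From mathcomp Require Import all_boot all_order all_algebra.
From mathcomp Require Import complex.
From mathcomp Require Import all_classical all_reals all_analysis.
From mathcomp Require Import measurable_realfun ring lra.
Import Order.TTheory GRing.Theory Num.Theory.
Import numFieldNormedType.Exports.

Local Open Scope classical_set_scope.
Local Open Scope ring_scope.
Local Open Scope complex_scope.

Set Implicit Arguments.
Unset Strict Implicit.
Unset Printing Implicit Defensive.

(** The kernels tend to 0 at every point off the sphere while their mass does not, so dominated
    convergence cannot act in the variable y. The exponent [p] is chosen so that p - 1 = p s: the
    Jacobian w^(p-1) then cancels ((r l)^2 - r^2)^(-s) = r^(-2s) w^(-ps) up to a constant, and the
    remaining weight 1 / (1 + w^p) is at most 2 / (1 + w^2) as soon as p >= 2, that is s >= 1/2. The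
    changes of variables are carried out on nonnegative integrands with values in the extended
    reals, where Tonelli and monotone convergence ask for no integrability. Signs come back only at
    the end, by writing a bounded function g as (g + C) - C. Since constants do not decay, the
    intermediate lemmas speak of bounded continuous functions. *)

Notation tuples R m := (m.-tuple (measurableTypeR R)).
Notation leb R := (@lebesgue_measure R).

(** * Iterated integration and scaling for the product Lebesgue measure *)

Lemma ge0_integral_tuple_cons (R : realType) (m : nat) (F : tuples R m.+1 -> \bar R) :
  measurable_fun setT F -> (forall t, (0 <= F t)%E) ->
  (\int[lebesgue_tuple R m.+1]_t F t =
   \int[leb R]_a \int[lebesgue_tuple R m]_t F (tuple_cons (a, t)))%E.
Proof.
move=> mF F0 /=.
rewrite (ge0_integral_pushforward (@measurable_tuple_cons R m) (leb R \x lebesgue_tuple R m)%E)//.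
rewrite preimage_setT fubini_tonelli1//=.
apply: measurableT_comp => //; exact: measurable_tuple_cons.
Qed.

Definition tuple_rcons (R : realType) (m : nat) (p : tuples R m * measurableTypeR R) :
  tuples R m.+1 := [tuple of rcons p.1 p.2].

Lemma tnth_tuple_rcons (R : realType) (m : nat) (t : tuples R m) (a : R) (i : 'I_m.+1) :
  tnth (tuple_rcons (t, a)) i =
  if insub (i : nat) is Some k then tnth t k else a.
Proof.
rewrite (tnth_nth a) /= nth_rcons size_tuple.
case: insubP => [k -> <-|]; first by rewrite (tnth_nth a).
by move=> /negPf ->; case: ifP.
Qed.

Lemma measurable_tuple_rcons (R : realType) (m : nat) :
  measurable_fun setT (@tuple_rcons R m).
Proof.
apply/measurable_fun_tnthP => i /=.
rewrite (_ : _ \o _ = fun p => if insub (i : nat) is Some k then tnth p.1 k else p.2).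
  case: insubP => [k _ _|_]; last exact: measurable_snd.
  exact: measurableT_comp (measurable_tnth k) _.
by apply/funext => -[t a]/=; rewrite tnth_tuple_rcons.
Qed.

(** [lebesgue_tuple] grows by prepending coordinates, whereas the hemispheres are graphs of the last
    coordinate, which therefore has to be split off. The induction peels the first coordinate off
    both sides; in the base case the integrals over empty tuples are Dirac integrals. *)
Lemma ge0_integral_tuple_rcons (R : realType) (m : nat) (F : tuples R m.+1 -> \bar R) :
  measurable_fun setT F -> (forall t, (0 <= F t)%E) ->
  (\int[lebesgue_tuple R m.+1]_t F t =
   \int[lebesgue_tuple R m]_t \int[leb R]_a F (tuple_rcons (t, a)))%E.
Proof.
elim: m F => [|m IH] F mF F0.
  rewrite ge0_integral_tuple_cons//= integral_dirac//=; last first.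
    rewrite (_ : (fun _ => _) = cst (\int[leb R]_a F (tuple_rcons ([tuple], a)))%E)//.
    by apply/funext => t /=; rewrite (tuple0 t).
  rewrite diracT mul1e; apply: eq_integral => a _.
  rewrite integral_dirac//=; last first.
    rewrite (_ : (fun _ => _) = cst (F (tuple_cons (a, [tuple]))))//.
    by apply/funext => t /=; rewrite (tuple0 t).
  by rewrite diracT mul1e; congr F; apply: val_inj.
rewrite ge0_integral_tuple_cons//.
rewrite [RHS]ge0_integral_tuple_cons//; last 2 first.
- apply: (measurable_fun_fubini_tonelli_F
    (fun p => F (@tuple_rcons R m.+1 p))) => //.
  by apply: measurableT_comp => //; exact: measurable_tuple_rcons.
- by move=> t; exact: integral_ge0.
apply: eq_integral => b _; rewrite IH//; last first.
  apply: (@measurableT_comp _ _ _ _ _ _ F) => //.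
  apply: (@measurableT_comp _ _ _ _ _ _ (@tuple_cons R m.+1)).
    exact: measurable_tuple_cons.
  exact: measurable_fun_pair.
apply: eq_integral => t _; apply: eq_integral => a _.
by congr F; apply: val_inj.
Qed.

(** Both sides are measures in [A], so by uniqueness it suffices to compare them on half-open
    intervals. *)
Lemma lebesgue_measure_scale (R : realType) (a : R) (A : set R) :
  a != 0 -> measurable A ->
  (leb R A = `|a|%:E * leb R ((fun x : measurableTypeR R => (a * x)%R) @^-1` A))%E.
Proof.
move=> a0 mA.
have ma : measurable_fun setT ((fun x => a * x) : measurableTypeR R -> measurableTypeR R).
  exact: measurable_funM.
pose push := [the measure _ _ of
  measure_function_pushforward__canonical__measure_function_Measure (leb R) ma].
pose k := NngNum (normr_ge0 a).
rewrite (_ : (_ * _)%E = mscale k push A)//.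
apply: lebesgue_measure_unique => //= _ [[x y]] _ <-.
rewrite /mscale/= /pushforward.
(* For negative [a] the preimage is half-open at the other end; its length is unaffected. *)
rewrite (_ : _ @^-1` _ = if 0 < a then `]x / a, y / a]%classic
                        else `[y / a, x / a[%classic); last first.
  apply/seteqP; split => z; case: ltP => [ap|an]/=; rewrite !in_itv/=.
  - by rewrite ltr_pdivrMr// ler_pdivlMr// mulrC.
  - have {}an : a < 0 by rewrite lt_neqAle a0.
    by rewrite ltr_ndivlMr// ler_ndivrMr// mulrC => /andP[-> ->].
  - by rewrite ltr_pdivrMr// ler_pdivlMr// mulrC.
  - have {}an : a < 0 by rewrite lt_neqAle a0.
    by rewrite ltr_ndivlMr// ler_ndivrMr// mulrC => /andP[-> ->].
case: ltP => [ap|an].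
  rewrite !lebesgue_measure_itv/= !lte_fin ltr_pM2r ?invr_gt0//.
  case: ifPn => // _; last by rewrite mule0.
  by rewrite -!EFinB -EFinM -mulrBl gtr0_norm// mulrC divfK.
have {}an : a < 0 by rewrite lt_neqAle a0.
rewrite !lebesgue_measure_itv/= !lte_fin ltr_nM2r ?invr_lt0//.
case: ifPn => // _; last by rewrite mule0.
by rewrite -!EFinB -EFinM -mulrBl ltr0_norm// mulrC mulrN divfK// opprB.
Qed.

Lemma ge0_integral_scale (R : realType) (a : R) (F : measurableTypeR R -> \bar R) :
  a != 0 -> measurable_fun setT F -> (forall x, (0 <= F x)%E) ->
  (\int[leb R]_x F x = `|a|%:E * \int[leb R]_x F (a * x)%R)%E.
Proof.
move=> a0 mF F0.
have ma : measurable_fun setT ((fun x => a * x) : measurableTypeR R -> measurableTypeR R).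
  exact: measurable_funM.
pose push := [the measure _ _ of
  measure_function_pushforward__canonical__measure_function_Measure (leb R) ma].
pose k := NngNum (normr_ge0 a).
rewrite (@eq_measure_integral _ _ _ _ (mscale k push))/=; last first.
  by move=> A mA _; exact: lebesgue_measure_scale.
rewrite ge0_integral_mscale//=; congr (_ * _)%E.
by rewrite (ge0_integral_pushforward ma)//= preimage_setT.
Qed.

Definition tuple_scale (R : realType) (m : nat) (a : R) (t : tuples R m) : tuples R m :=
  [tuple of map (fun x => a * x) t].

Lemma measurable_tuple_scale (R : realType) (m : nat) (a : R) :
  measurable_fun setT (@tuple_scale R m a).
Proof.
apply/measurable_fun_tnthP => i /=.
rewrite (_ : _ \o _ = fun t => a * tnth t i).
  by apply: measurable_funM => //; exact: measurable_tnth.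
by apply/funext => t /=; rewrite tnth_map.
Qed.

Lemma ge0_integral_tuple_scale (R : realType) (m : nat) (a : R)
    (F : tuples R m -> \bar R) :
  a != 0 -> measurable_fun setT F -> (forall x, (0 <= F x)%E) ->
  (\int[lebesgue_tuple R m]_t F t =
   (`|a| ^+ m)%:E * \int[lebesgue_tuple R m]_t F (tuple_scale a t))%E.
Proof.
move=> a0; elim: m F => [|m IH] F mF F0.
  rewrite expr0 mul1e; apply: eq_integral => t _; congr F.
  by rewrite (tuple0 t) (tuple0 (tuple_scale _ _)).
have mFc : measurable_fun setT (fun p => F (tuple_cons p)).
  by apply: (@measurableT_comp _ _ _ _ _ _ F) => //; exact: measurable_tuple_cons.
have mS : measurable_fun setT (fun p : measurableTypeR R * tuples R m =>
    F (tuple_cons (p.1, tuple_scale a p.2))).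
  apply: (@measurableT_comp _ _ _ _ _ _ F) => //.
  apply: (@measurableT_comp _ _ _ _ _ _ (@tuple_cons R m)).
    exact: measurable_tuple_cons.
  apply: measurable_fun_pair => //.
  by apply: (@measurableT_comp _ _ _ _ _ _ (@tuple_scale R m a)) => //;
    exact: measurable_tuple_scale.
rewrite ge0_integral_tuple_cons//.
under eq_integral => x _.
  rewrite IH//; last first.
    exact: measurableT_comp mFc (pair1_measurable x).
  over.
rewrite ge0_integralZl//=; last 2 first.
- exact: (measurable_fun_fubini_tonelli_F _ mS).
- by move=> x _; exact: integral_ge0.
rewrite (ge0_integral_scale a0)//; last 2 first.
- exact: (measurable_fun_fubini_tonelli_F _ mS).
- by move=> x; exact: integral_ge0.
rewrite muleA -EFinM -exprSr; congr (_ * _)%E.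
rewrite ge0_integral_tuple_cons//; last first.
  by apply: (@measurableT_comp _ _ _ _ _ _ F) => //; exact: measurable_tuple_scale.
apply: eq_integral => x _; apply: eq_integral => t _.
by congr F; apply: val_inj.
Qed.

Lemma measurable_tuple_cube (R : realType) (m : nat) (M : R) :
  measurable [set t : tuples R m | forall i, `|tnth t i| <= M].
Proof.
rewrite (_ : [set _ | _] = \bigcap_(i in [set: 'I_m]) ((fun t => tnth t i) @^-1` `[-M, M])).
  apply: fin_bigcap_measurable => // i _.
  by rewrite -[X in measurable X]setTI; exact: measurable_tnth.
apply/seteqP; split => t /= h i => [_|]; first by rewrite /= in_itv/= -ler_norml.
by have := h i I; rewrite /= in_itv/= -ler_norml.
Qed.

(** Serves to bound the integral of a bounded function that vanishes outside a cube. *)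
Lemma lebesgue_tuple_cube (R : realType) (m : nat) (M : R) : 0 <= M ->
  lebesgue_tuple R m [set t | forall i, `|tnth t i| <= M] = ((M + M) ^+ m)%:E.
Proof.
move=> M0; elim: m => [|m IH].
  rewrite /= diracE mem_set ?expr0//= => -[]//.
rewrite /= /tuple_cons_measure /pushforward.
rewrite (_ : _ @^-1` _ = `[-M, M]%classic `*` [set t : tuples R m | forall i, `|tnth t i| <= M]).
  rewrite product_measure1E//.
    rewrite exprS EFinM; congr (_ * _)%E; last exact: IH.
    transitivity (leb R `[-M, M]%classic); first by [].
    rewrite lebesgue_measure_itv/= lte_fin; case: ltP => [_|].
      by rewrite -EFinB opprK.
    by move=> h; congr EFin; lra.
  exact: measurable_tuple_cube.
apply/seteqP; split => -[x t]/=.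
  move=> h; split; first by have := h ord0; rewrite in_itv/= -ler_norml.
  by move=> i; have := h (lift ord0 i); rewrite tnthS.
move=> [xM tM] i; case: (unliftP ord0 i) => [j ->|->]; first by rewrite tnthS.
by move: xM; rewrite in_itv/= -ler_norml.
Qed.

(** * Measurability of continuous functions of row vectors *)

Lemma cvg_row (R : realType) (T : Type) (F : set_system T) (m : nat)
    (f : T -> 'rV[R]_m) (l : 'rV[R]_m) : Filter F ->
  (forall i, f x 0 i @[x --> F] --> l 0 i) -> f x @[x --> F] --> l.
Proof.
move=> FF h; apply/cvg_ballP => e e0.
have : \forall x \near F, forall i, ball (l 0 i) e (f x 0 i).
  by apply: filter_forall => i; move: (h i) => /cvg_ballP; exact.
by apply: filterS => x hx; split=> // i j; rewrite ord1; exact: hx.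
Qed.

(* The product sigma-algebra contains the Borel sets: [f] is the pointwise limit
   of functions that only depend on the integer parts of [k * t_i]. *)
Lemma measurable_continuous_row (R : realType) (m : nat) (f : 'rV[R]_m -> R) :
  continuous f -> measurable_fun setT (fun t : tuples R m => f (row_of_tuple t)).
Proof.
move=> cf.
pose g (k : nat) (z : m.-tuple int) : 'rV[R]_m :=
  \row_i ((tnth z i)%:~R / k.+1%:R).
pose q (k : nat) (t : tuples R m) : m.-tuple int :=
  [tuple Num.floor (tnth t i * k.+1%:R) | i < m].
apply: (@measurable_fun_cvg _ _ _ _ (fun k t => f (g k (q k t)))).
  move=> k _ A mA; rewrite setTI.
  (* The approximant is constant on each cell of a grid of mesh 1 / (k + 1), and the cells are
     indexed by the countable type of integer tuples. *)
  rewrite (_ : _ @^-1` _ = \bigcup_(z in [set: m.-tuple int])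
      (if `[< A (f (g k z)) >] then \bigcap_(i in [set: 'I_m])
        ((fun t => Num.floor (tnth t i * k.+1%:R)) @^-1` [set tnth z i]) else set0)); last first.
    apply/seteqP; split => t /=.
      move=> At; exists (q k t) => //; rewrite asboolT// => i _ /=.
      by rewrite tnth_mktuple.
    move=> [z _]; case: asboolP => // Az h.
    suff -> : q k t = z by [].
    by apply: eq_from_tnth => i; rewrite tnth_mktuple; exact: h.
  apply: countable_bigcupT_measurable; first exact: countableP.
  move=> z; case: ifP => // _.
  apply: fin_bigcap_measurable => // i _.
  rewrite (_ : _ @^-1` _ = (fun t => tnth t i * k.+1%:R) @^-1`
      `[(tnth z i)%:~R, (tnth z i + 1)%:~R[).
    rewrite -[X in measurable X]setTI.
    have : measurable_fun setT (fun t : tuples R m => (tnth t i : R) * k.+1%:R).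
      by apply: measurable_funM => //; exact: measurable_tnth.
    exact.
  apply/seteqP; split => t /=; rewrite in_itv/=.
    by move=> <-; rewrite floor_le floorD1_gt.
  by move=> h; exact: floor_def.
move=> t _; apply: continuous_cvg; first exact: cf.
apply: cvg_row => i; rewrite mxE.
apply/cvgrPdist_lt => e e0; near=> k.
rewrite mxE tnth_mktuple.
have k0 : (0 : R) < k.+1%:R by [].
set y := tnth t i * k.+1%:R.
have /andP[fy yf] := floor_itv y; rewrite intrD1 in yf.
rewrite (_ : _ - _ = (y - (Num.floor y)%:~R) / k.+1%:R); last first.
  by rewrite mulrBl /y mulfK ?gt_eqF.
rewrite ger0_norm; last by rewrite mulr_ge0 ?subr_ge0.
apply: (@le_lt_trans _ _ k.+1%:R^-1).
  by rewrite ler_pdivrMr// mulVf ?gt_eqF// lerBlDl ltW.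
by near: k; exact: near_infty_natSinv_lt (PosNum e0).
Unshelve. all: by end_near. Qed.

(** * Substitution on a half-line *)

(** Nothing is assumed at [a], where [dphi] may blow up. The half-line is exhausted by the compact
    intervals from [l n] to [h n], the substitution is made on each, and monotone convergence passes
    to the limit on both sides. The right inverse [psi] provides surjectivity. *)
Lemma ge0_integration_by_substitution_oy (R : realType) (phi dphi psi G : R -> R) (a b : R) :
  (forall x, a < x -> is_derive x (1 : R) phi (dphi x)) ->
  (forall x, a < x -> {for x, continuous dphi}) ->
  (forall x, a < x -> 0 < dphi x) ->
  (forall x, a < x -> b < phi x) ->
  (forall t, b < t -> a < psi t /\ phi (psi t) = t) ->
  (forall t, b < t -> {for t, continuous G}) ->
  (forall t, b < t -> 0 <= G t) ->
  (\int[leb R]_(t in `]b, +oo[) (G t)%:E =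
   \int[leb R]_(x in `]a, +oo[) (G (phi x) * dphi x)%:E)%E.
Proof.
move=> Dphi cdphi dphi0 phib psiP cG G0.
pose l (n : nat) : R := a + n.+1%:R^-1.
pose h (n : nat) : R := a + n.+1%:R.
have al n : a < l n by rewrite ltrDl.
have lh n : l n <= h n.
  by rewrite lerD2l (@le_trans _ _ 1)// ?invf_le1// ler1n.
have nbd : {homo l : i j / (i <= j)%N >-> j <= i}.
  by move=> i j ij; rewrite lerD2l lef_pV2 ?posrE// ler_nat.
have nbh : {homo h : i j / (i <= j)%N >-> i <= j}.
  by move=> i j ij; rewrite lerD2l ler_nat.
have cphi x : a < x -> {for x, continuous phi}.
  move=> ax; apply/differentiable_continuous/derivable1_diffP.
  by have [] := Dphi x ax.
have incr x y : a < x -> x < y -> phi x < phi y.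
  move=> ax xy.
  apply: (@gtr0_derive1_incr _ phi x y) => //.
  - by move=> z; rewrite in_itv/= => /andP[xz _]; have [] := Dphi z (lt_trans ax xz).
  - move=> z; rewrite in_itv/= => /andP[xz _]; rewrite derive1E.
    by have [_ ->] := Dphi z (lt_trans ax xz); exact/dphi0/(lt_trans ax).
  - apply: continuous_in_subspaceT => z; rewrite inE/= in_itv/= => /andP[xz _].
    exact/cphi/(lt_le_trans ax).
have incrW x y : a < x -> x <= y -> phi x <= phi y.
  by move=> ax; rewrite le_eqVlt => /predU1P[->//|xy]; exact/ltW/incr.
(* Once [psi t] lies between [l n] and [h n], monotonicity puts t = phi (psi t) between their
   images. *)
have cF t : b < t -> exists n, `[phi (l n), phi (h n)]%classic t.
  move=> bt; have [ap ft] := psiP t bt.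
  have [N1 _ H1] : \forall n \near \oo, n.+1%:R^-1 < psi t - a.
    by apply: (near_infty_natSinv_lt (@PosNum _ (psi t - a) _)); rewrite subr_gt0.
  pose N2 := (Num.truncn (psi t - a)).+1.
  exists (maxn N1 N2); rewrite /= in_itv/= -{1 2}ft; apply/andP; split.
    apply: incrW => //; rewrite /l -lerBrDl ltW//; apply: H1 => /=; exact: leq_maxl.
  apply: incrW => //; rewrite /h -lerBlDl ltW// (@lt_le_trans _ _ N2%:R)//.
    exact: truncnS_gt.
  by rewrite ler_nat leqW// leq_maxr.
have -> : `]b, +oo[%classic = \bigcup_n `[phi (l n), phi (h n)]%classic.
  apply/seteqP; split => t/=; rewrite in_itv/= ?andbT.
    by move=> bt; have [n nt] := cF t bt; exists n.
  by move=> [n _]; rewrite /= in_itv/= => /andP[+ _]; exact/lt_le_trans/phib.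
(* The same covering of the target is pulled back: [phi] is strictly increasing, so the order of the
   images determines the order of the points. *)
have E : `]a, +oo[%classic = \bigcup_n `[l n, h n]%classic.
  apply/seteqP; split => x/=; rewrite in_itv/= ?andbT.
    move=> ax; have [n] := cF (phi x) (phib x ax); rewrite /= in_itv/= => /andP[lx xh].
    exists n => //; rewrite /= in_itv/=; apply/andP; split; rewrite leNgt; apply/negP.
      by move=> /(incr _ _ ax); rewrite ltNge lx.
    by move=> /(incr _ _ (lt_le_trans (al n) (lh n))); rewrite ltNge xh.
  by move=> [n _]; rewrite /= in_itv/= => /andP[+ _]; exact/lt_le_trans/al.
have dE x : a < x -> derive1 phi x = dphi x.
  by move=> ax; rewrite derive1E; have [_ ->] := Dphi x ax.
have cD x : a < x -> {for x, continuous (derive1 phi)}.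
  move=> ax; rewrite /prop_for /continuous_at dE//.
  apply: cvg_trans (cdphi x ax); apply: near_eq_cvg.
  by near=> y; rewrite dE//; near: y; exact: lt_nbhsr.
have step n : (\int[leb R]_(t in `[phi (l n), phi (h n)]) (G t)%:E =
   \int[leb R]_(x in `[l n, h n]) (G (phi x) * dphi x)%:E)%E.
  have ah := lt_le_trans (al n) (lh n).
  rewrite integration_by_substitution_increasing//.
  - apply: eq_integral => x; rewrite inE/= in_itv/= => /andP[lx _] /=.
    by rewrite fctE dE ?(lt_le_trans (al n)).
  - move=> x y; rewrite !in_itv/= => /andP[lx _] _; exact/incr/(lt_le_trans (al n)).
  - by move=> x; rewrite in_itv/= => /andP[lx _]; exact/cD/(lt_trans (al n)).
  - by apply/cvg_ex; exists ((derive1 phi) (l n)); exact/cvg_at_right_filter/cD.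
  - by apply/cvg_ex; exists ((derive1 phi) (h n)); exact/cvg_at_left_filter/cD.
  - split.
    + by move=> x; rewrite in_itv/= => /andP[lx _]; have [] := Dphi x (lt_trans (al n) lx).
    + exact/cvg_at_right_filter/cphi.
    + exact/cvg_at_left_filter/cphi.
  apply: continuous_in_subspaceT => t; rewrite inE/= in_itv/= => /andP[lt _].
  exact/cG/(lt_le_trans _ lt)/phib.
rewrite E.
have c1 : (\int[leb R]_(t in `[phi (l n), phi (h n)]) (G t)%:E)%E @[n --> \oo] -->
    (\int[leb R]_(t in \bigcup_n `[phi (l n), phi (h n)]%classic) (G t)%:E)%E.
  apply: ge0_nondecreasing_set_cvg_integral.
  - move=> i j ij; apply/subsetPset => t; rewrite /= !in_itv/= => /andP[lt th].
    rewrite (le_trans _ lt) ?incrW ?nbd//= (le_trans th)// incrW ?nbh//.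
    exact: lt_le_trans (al i) (lh i).
  - by move=> i; exact: measurable_itv.
  - move=> i; apply/measurable_EFinP.
    apply: subspace_continuous_measurable_fun => //.
    apply: continuous_in_subspaceT => t; rewrite inE/= in_itv/= => /andP[lt _].
    exact/cG/(lt_le_trans _ lt)/phib.
  - move=> i t; rewrite /= in_itv/= => /andP[lt _]; rewrite lee_fin.
    exact/G0/(lt_le_trans _ lt)/phib.
rewrite -(cvg_lim _ c1)//; apply/cvg_lim => //.
under eq_fun do rewrite step.
apply: ge0_nondecreasing_set_cvg_integral.
- move=> i j ij; apply/subsetPset => t; rewrite /= !in_itv/= => /andP[lt th].
  by rewrite (le_trans _ lt) ?nbd//= (le_trans th)// nbh.
- by move=> i; exact: measurable_itv.
- move=> i; apply/measurable_EFinP.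
  apply: subspace_continuous_measurable_fun => //.
  apply: continuous_in_subspaceT => t; rewrite inE/= in_itv/= => /andP[lt _].
  have at_ := lt_le_trans (al i) lt.
  apply: continuousM; last exact: cdphi.
  by apply: continuous_comp; [exact: cphi|exact/cG/phib].
- move=> i t; rewrite /= in_itv/= => /andP[lt _]; rewrite lee_fin.
  have at_ := lt_le_trans (al i) lt.
  by rewrite mulr_ge0 ?G0 ?phib// ltW// dphi0.
Unshelve. all: by end_near. Qed.

Lemma is_derive_powR (R : realType) (p w : R) : 0 < w ->
  is_derive w (1 : R) (fun x => x `^ p) (p * w `^ (p - 1)).
Proof.
move=> w0; split; first by apply: derivable_powR; rewrite in_itv/= andbT.
by rewrite -derive1E powR_derive1// in_itv/= andbT.
Qed.

Lemma continuous_powR (R : realType) (p w : R) : 0 < w ->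
  {for w, continuous (fun x : R => x `^ p)}.
Proof.
move=> w0; apply/differentiable_continuous/derivable1_diffP.
by have [] := is_derive_powR p w0.
Qed.

Lemma ltr_sqrtl (R : rcfType) (x y : R) : 0 <= y -> (Num.sqrt x < y) = (0 < y) && (x < y ^+ 2).
Proof.
move=> y0; have [->|] := eqVneq y 0.
  by rewrite ltxx ltNge sqrtr_ge0.
move=> yn0; have yp : 0 < y by rewrite lt_neqAle eq_sym yn0.
rewrite yp /=; case: (leP 0 x) => x0.
  by rewrite -[in LHS](ger0_norm y0) -sqrtr_sqr ltr_sqrt// exprn_gt0.
by rewrite ler0_sqrtr ?ltW// yp (lt_trans x0)// exprn_gt0.
Qed.

(* [w ↦ sqrt (r^2 (1 + w^p) - q)] maps the half-line [w > a] onto [t > b]. *)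
Lemma ge0_integral_radial_substitution (R : realType) (r p q : R) (G : R -> R) :
  0 < r -> 0 < p -> 0 <= q ->
  (forall t, 0 < t -> r ^+ 2 < q + t ^+ 2 -> {for t, continuous G}) ->
  (forall t, 0 < t -> r ^+ 2 < q + t ^+ 2 -> 0 <= G t) ->
  let D w := r ^+ 2 * (1 + w `^ p) - q in
  (\int[leb R]_t (if (0 < t) && (r ^+ 2 < q + t ^+ 2) then G t else 0)%:E =
   \int[leb R]_w (if (0 < w) && (0 < D w) then
      G (Num.sqrt (D w)) * (r ^+ 2 * (p * w `^ (p - 1)) / (2 * Num.sqrt (D w)))
      else 0)%:E)%E.
Proof.
move=> r0 p0 q0 cG G0 D.
have r20 : 0 < r ^+ 2 by rewrite exprn_gt0.
(* Both end points cover two cases. For q < r^2 the vertical line meets the sphere: b > 0 and a = 0.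
   For q >= r^2 it starts outside or on it: [Num.sqrt] sends a nonpositive number to 0, so b = 0,
   and [a] is the root of D. *)
pose b := Num.sqrt (r ^+ 2 - q).
pose a := (Num.max 0 (q / r ^+ 2 - 1)) `^ p^-1.
have pi0 : 0 < p^-1 by rewrite invr_gt0.
have powK x : 0 <= x -> (x `^ p^-1) `^ p = x.
  by move=> x0; rewrite -powRrM mulVf ?gt_eqF// powRr1.
have powK' x : 0 <= x -> (x `^ p) `^ p^-1 = x.
  by move=> x0; rewrite -powRrM mulfV ?gt_eqF// powRr1.
have bE t : (b < t) = (0 < t) && (r ^+ 2 < q + t ^+ 2).
  case: (ltP 0 t) => t0 /=; first by rewrite ltr_sqrtl ?ltW// t0/= ltrBlDl.
  by apply/negbTE; rewrite -leNgt (le_trans t0)// sqrtr_ge0.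
have a0 : 0 <= a by exact: powR_ge0.
have mx0 : 0 <= Num.max 0 (q / r ^+ 2 - 1) by rewrite le_max lexx.
have aE w : (a < w) = (0 < w) && (0 < D w).
  case: (ltP 0 w) => w0 /=; last by apply/negbTE; rewrite -leNgt (le_trans w0).
  transitivity (Num.max 0 (q / r ^+ 2 - 1) < w `^ p).
    apply/idP/idP => h.
      by rewrite -[X in X < _]powK// gt0_ltr_powR// nnegrE ltW.
    by rewrite -[X in _ < X]powK' ?ltW// gt0_ltr_powR// nnegrE ?powR_ge0.
  by rewrite gt_max powR_gt0//= ltrBlDl ltr_pdivrMr// subr_gt0 mulrC.
pose phi w := Num.sqrt (D w).
pose dphi w := r ^+ 2 * (p * w `^ (p - 1)) / (2 * Num.sqrt (D w)).
pose psi t := ((q + t ^+ 2) / r ^+ 2 - 1) `^ p^-1.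
transitivity (\int[leb R]_(t in `]b, +oo[) (G t)%:E)%E.
  rewrite [RHS]integral_mkcond; apply: eq_integral => t _.
  by rewrite patchE -bE mem_setE in_itv/= andbT; case: ifP.
transitivity (\int[leb R]_(w in `]a, +oo[) (G (phi w) * dphi w)%:E)%E; last first.
  rewrite [LHS]integral_mkcond; apply: eq_integral => w _.
  by rewrite patchE -aE mem_setE in_itv/= andbT; case: ifP.
have DD (w : R) : 0 < w -> is_derive w (1 : R) D (r ^+ 2 * (p * w `^ (p - 1))).
  move=> w0; have dp := is_derive_powR p w0.
  have := is_deriveB (is_deriveZ (r ^+ 2) (is_deriveD (is_derive_cst (1 : R) w 1) dp))
    (is_derive_cst q w 1).
  by rewrite subr0 add0r.
apply: (@ge0_integration_by_substitution_oy _ _ _ psi).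
- move=> w; rewrite aE => /andP[w0 Dw0]; rewrite /phi.
  have := @is_derive1_comp _ _ _ w _ _ (is_derive1_sqrt Dw0) (DD w w0).
  by rewrite mulrC.
- move=> w; rewrite aE => /andP[w0 Dw0].
  apply: continuousM.
    apply: continuousM; first exact: cst_continuous.
    by apply: continuousM; [exact: cst_continuous|exact: continuous_powR].
  apply: continuousV; first by rewrite mulf_neq0// gt_eqF// sqrtr_gt0.
  apply: continuousM; first exact: cst_continuous.
  apply: continuous_comp; last exact: sqrt_continuous.
  apply/differentiable_continuous/derivable1_diffP.
  by have [] := DD w w0.
- move=> w; rewrite aE => /andP[w0 Dw0].
  by rewrite divr_gt0// ?mulr_gt0// ?powR_gt0 ?sqrtr_gt0.
- move=> w; rewrite aE bE => /andP[w0 Dw0].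
  rewrite sqrtr_gt0 Dw0/= sqr_sqrtr ?ltW// /D.
  by rewrite addrC subrK mulrDr mulr1 ltrDl mulr_gt0// powR_gt0.
- move=> t; rewrite bE => /andP[t0 qt].
  have s0 : 0 < (q + t ^+ 2) / r ^+ 2 - 1 by rewrite subr_gt0 ltr_pdivlMr// mul1r.
  have Dp : D (psi t) = t ^+ 2.
    rewrite /D /psi powK ?ltW// [1 + _]addrC subrK.
    by rewrite mulrC divfK ?gt_eqF// addrC addKr.
  split; last by rewrite /phi Dp sqrtr_sqr ger0_norm// ltW.
  by rewrite aE Dp exprn_gt0// andbT powR_gt0.
- by move=> t; rewrite bE => /andP[]; exact: cG.
- by move=> t; rewrite bE => /andP[]; exact: G0.
Qed.

(** * Measurability of elementary operations and the Euclidean norm *)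

(** On nonnegative values, 0 included, inversion is the power -1; negative values reduce to these by
    a change of sign. *)
Lemma measurable_funV (d : measure_display) (T : measurableType d) (R : realType)
    (f : T -> R) : measurable_fun setT f -> measurable_fun setT (fun x => (f x)^-1).
Proof.
move=> mf.
have E x : (f x)^-1 = if 0 <= f x then f x `^ (-1) else - ((- f x) `^ (-1)).
  case: (leP 0 (f x)) => fx; first by rewrite powR_inv1.
  by rewrite powR_inv1 ?oppr_ge0 1?ltW// invrN opprK.
under eq_fun do rewrite E.
apply: measurable_fun_ifT.
- exact: measurable_fun_ler.
- exact: measurableT_comp (measurable_powR _) mf.
- apply: measurableT_comp => //.
  by apply: measurableT_comp (measurable_powR _) _; exact: measurableT_comp mf.
Qed.

Lemma measurable_fun_sqrt (d : measure_display) (T : measurableType d) (R : realType)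
    (f : T -> R) : measurable_fun setT f -> measurable_fun setT (fun x => Num.sqrt (f x)).
Proof.
move=> mf; apply: (@measurableT_comp _ _ _ _ _ _ (@Num.sqrt R)) => //.
apply: continuous_measurable_fun; exact: sqrt_continuous.
Qed.

Lemma enorm_ge0 (R : realType) (m : nat) (y : 'rV[R]_m) : 0 <= enorm y.
Proof. exact: sqrtr_ge0. Qed.

Lemma enorm_sqr (R : realType) (m : nat) (y : 'rV[R]_m) : enorm y ^+ 2 = \sum_i y 0 i ^+ 2.
Proof. by rewrite sqr_sqrtr// sumr_ge0// => i _; exact: sqr_ge0. Qed.

Lemma enormZ (R : realType) (m : nat) (a : R) (y : 'rV[R]_m) :
  enorm (a *: y) = `|a| * enorm y.
Proof.
rewrite -[in RHS]sqrtr_sqr -sqrtrM ?sqr_ge0// /enorm mulr_sumr.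
by congr Num.sqrt; apply: eq_bigr => i _; rewrite mxE exprMn.
Qed.

Lemma enorm_snoc (R : realType) (m : nat) (y : 'rV[R]_m) (t : R) :
  enorm (@row_snoc R m.+1 y t) = Num.sqrt (enorm y ^+ 2 + t ^+ 2).
Proof.
rewrite enorm_sqr /enorm big_ord_recr/=; congr (Num.sqrt (_ + _ ^+ 2)).
  apply: eq_bigr => i _; rewrite mxE; case: insubP => [k _ ki|]; last by rewrite /= ltn_ord.
  by congr (y 0 _ ^+ 2); apply: val_inj.
by rewrite mxE insubF//= ltnn.
Qed.

Lemma row_of_tuple_rcons (R : realType) (m : nat) (t : tuples R m) (a : R) :
  row_of_tuple (tuple_rcons (t, a)) = @row_snoc R m.+1 (row_of_tuple t) a.
Proof.
apply/rowP => i; rewrite !mxE tnth_tuple_rcons.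
by case: insubP => // k; rewrite mxE.
Qed.

Lemma row_of_tuple_scale (R : realType) (m : nat) (t : tuples R m) (a : R) :
  row_of_tuple (tuple_scale a t) = a *: row_of_tuple t.
Proof. by apply/rowP => i; rewrite !mxE tnth_map. Qed.

Lemma row_snocZ (R : realType) (m : nat) (a : R) (y : 'rV[R]_m) (t : R) :
  @row_snoc R m.+1 (a *: y) (a * t) = a *: @row_snoc R m.+1 y t.
Proof. by apply/rowP => i; rewrite !mxE; case: insub => // k; rewrite mxE. Qed.

Lemma measurable_enorm (R : realType) (m : nat) :
  measurable_fun setT (fun t : tuples R m => enorm (row_of_tuple t)).
Proof.
apply: measurable_fun_sqrt; apply: measurable_sum => i.
under eq_fun do rewrite mxE.
by apply: measurable_funX; exact: measurable_tnth.
Qed.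

(** * Polar coordinates through hemispheres *)

(** Folding the line at 0 pairs the points above and below the equatorial hyperplane; this is how
    the two hemispheres come to be summed. *)
Lemma ge0_integral_halfline (R : realType) (f : R -> R) :
  measurable_fun setT f -> (forall x, 0 <= f x) ->
  (\int[leb R]_x (f x)%:E =
   \int[leb R]_x (if (0 < x)%R then f x + f (- x)%R else 0)%:E)%E.
Proof.
move=> mf f0.
have mfN : measurable_fun setT (fun x : R => f (- x)) by exact: measurableT_comp.
transitivity (\int[leb R]_(x in `]0%R, +oo[) (f x)%:E +
              \int[leb R]_(x in `]0%R, +oo[) (f (- x))%:E)%E.
  rewrite (_ : [set: _] = `]-oo, 0%R]%classic `|` `]0%R, +oo[%classic); last first.
    by rewrite -setCitvr setvU.
  rewrite ge0_integral_setU//=; last 3 first.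
  - exact/measurable_EFinP/measurable_funTS.
  - by move=> x _; rewrite lee_fin.
  - rewrite disj_set2E; apply/eqP; rewrite -subset0 => x.
    by move=> []/= /[!in_itv]/= + /andP[+ _]; rewrite leNgt => /negP.
  rewrite addeC; congr (_ + _)%E.
  rewrite [RHS]integral_itv_obnd_cbnd; last exact/measurable_EFinP/measurable_funTS.
  rewrite (@ge0_integration_by_substitution0 R (fun x => (f (- x))%:E)); last 2 first.
  - exact/measurable_EFinP.
  - by move=> x; rewrite lee_fin.
  by apply: eq_integral => x _; rewrite opprK.
rewrite -ge0_integralD//=; last 4 first.
- by move=> x _; rewrite lee_fin.
- exact/measurable_EFinP/measurable_funTS.
- by move=> x _; rewrite lee_fin.
- exact/measurable_EFinP/measurable_funTS.
rewrite integral_mkcond; apply: eq_integral => x _.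
by rewrite patchE mem_setE in_itv/= andbT; case: ifP => // _; rewrite EFinD.
Qed.

(** The two points are those of the sphere of radius [r * l] over [l *: y]. With this scaling [y]
    ranges over the same ball of radius [r] for every [l]. *)
Definition hemi_sum (R : realType) (m : nat) (v : 'rV[R]_m.+1 -> R) (r l : R) (y : 'rV[R]_m) : R :=
  let h := Num.sqrt (r ^+ 2 - enorm y ^+ 2) in
  v (l *: @row_snoc R m.+1 y h) + v (l *: @row_snoc R m.+1 y (- h)).

(** The factor [l ^+ m] is the Jacobian of the scaling of the first m coordinates. The last factor
    is the derivative in [w] of the height of the point, which equals [l] times the square root of
    r^2 - |y|^2 after that scaling. *)
Definition polar_integrand (R : realType) (m : nat) (r p : R) (k : R -> R)
    (v : 'rV[R]_m.+1 -> R) (w : R) (y : 'rV[R]_m) : R :=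
  let l := Num.sqrt (1 + w `^ p) in
  if (0 < w) && (enorm y < r) then
    l ^+ m * (k (r * l) * hemi_sum v r l y *
      (r ^+ 2 * (p * w `^ (p - 1)) / (2 * (l * Num.sqrt (r ^+ 2 - enorm y ^+ 2)))))
  else 0.

(* Polar coordinates, with each sphere parametrised by its two hemispheres and
   its radius [r * l] by [w = (l ^ 2 - 1) ^ (1 / p)]. *)
Lemma ge0_integral_polar (R : realType) (m : nat) (r p : R) (k : R -> R)
    (v : 'rV[R]_m.+1 -> R) :
  0 < r -> 0 < p ->
  measurable_fun setT k ->
  (forall t, r < t -> {for t, continuous k}) -> (forall t, r < t -> 0 <= k t) ->
  continuous v -> (forall y, 0 <= v y) ->
  (\int[lebesgue_tuple R m.+1]_t
     (if r < enorm (row_of_tuple t) then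
        k (enorm (row_of_tuple t)) * v (row_of_tuple t) else 0)%:E =
   \int[leb R]_w \int[lebesgue_tuple R m]_t
     (polar_integrand r p k v w (row_of_tuple t))%:E)%E.
Proof.
move=> r0 p0 mk ck k0 cv v0.
pose l (w : R) := Num.sqrt (1 + w `^ p).
have mv := measurable_continuous_row cv.
pose D (y : 'rV[R]_m) w := r ^+ 2 * (1 + w `^ p) - enorm y ^+ 2.
pose F (y : 'rV[R]_m.+1) := if r < enorm y then k (enorm y) * v y else 0.
have F0 y : 0 <= F y by rewrite /F; case: ifP => // ry; rewrite mulr_ge0 ?k0.
have mF : measurable_fun setT (fun t : tuples R m.+1 => F (row_of_tuple t)).
  apply: measurable_fun_ifT => //.
    by apply: measurable_fun_ltr => //; exact: measurable_enorm.
  by apply: measurable_funM => //; apply: measurableT_comp mk _; exact: measurable_enorm.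
pose G (y : 'rV[R]_m) t := k (Num.sqrt (enorm y ^+ 2 + t ^+ 2)) *
  (v (@row_snoc R m.+1 y t) + v (@row_snoc R m.+1 y (- t))).
pose K (y : 'rV[R]_m) w := if (0 < w) && (0 < D y w) then
  G y (Num.sqrt (D y w)) * (r ^+ 2 * (p * w `^ (p - 1)) / (2 * Num.sqrt (D y w))) else 0.
have rlt (q t : R) : 0 <= q -> (r < Num.sqrt (q + t ^+ 2)) = (r ^+ 2 < q + t ^+ 2).
  move=> q0; rewrite -[in LHS](gtr0_norm r0) -sqrtr_sqr.
  rewrite !ltNge; congr negb; apply/idP/idP => h; last exact: ler_wsqrtr.
  by rewrite -ler_sqrt ?sqr_ge0.
have crs (y : 'rV[R]_m) : continuous (fun t => @row_snoc R m.+1 y t).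
  move=> t; apply: cvg_row => i; rewrite !mxE.
  rewrite [X in X @ _ --> _](_ : _ = fun t => if insub (i : nat) is Some k0 then y 0 k0 else t).
    by case: insub => [j|]; [exact: cvg_cst|exact: cvg_id].
  by apply/funext => s; rewrite mxE.
have K0 y w : 0 <= K y w.
  rewrite /K; case: ifP => // /andP[w0 D0].
  apply: mulr_ge0; last first.
    by rewrite divr_ge0 ?mulr_ge0 ?powR_ge0 ?sqrtr_ge0// ltW// exprn_gt0.
  rewrite mulr_ge0 ?addr_ge0 ?k0//.
  rewrite rlt ?sqr_ge0// (sqr_sqrtr (ltW D0)) /D addrC subrK.
  by rewrite mulrDr mulr1 ltrDl mulr_gt0 ?exprn_gt0// powR_gt0.
have mrow d (T : measurableType d) (f : T -> tuples R m) (g : T -> R) :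
    measurable_fun setT f -> measurable_fun setT g ->
    measurable_fun setT (fun x => v (@row_snoc R m.+1 (row_of_tuple (f x)) (g x))).
  move=> mf mg; under eq_fun do rewrite -row_of_tuple_rcons.
  apply: (measurableT_comp mv).
  apply: (measurableT_comp (@measurable_tuple_rcons R m)).
  exact: measurable_fun_pair.
have mK : measurable_fun setT
    (fun z : tuples R m * measurableTypeR R => K (row_of_tuple z.1) z.2).
  have mn : measurable_fun setT
      (fun z : tuples R m * measurableTypeR R => enorm (row_of_tuple z.1) ^+ 2).
    by apply: measurable_funX; exact: measurableT_comp (@measurable_enorm R m) measurable_fst.
  have mpow a : measurable_fun setT (fun z : tuples R m * measurableTypeR R => z.2 `^ a).
    exact: measurableT_comp (measurable_powR a) measurable_snd.
  have mD : measurable_fun setT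
      (fun z : tuples R m * measurableTypeR R => D (row_of_tuple z.1) z.2).
    by apply: measurable_funB => //; apply: measurable_funM => //; exact: measurable_funD.
  have msD := measurable_fun_sqrt mD.
  apply: measurable_fun_ifT => //.
    by apply: measurable_and; apply: measurable_fun_ltr => //; exact: measurable_snd.
  apply: measurable_funM.
    apply: measurable_funM.
      apply: measurableT_comp mk _; apply: measurable_fun_sqrt.
      by apply: measurable_funD => //; exact: measurable_funX.
    apply: measurable_funD; apply: mrow => //.
    exact: measurableT_comp msD.
  apply: measurable_funM.
    by apply: measurable_funM => //; exact: measurable_funM.
  by apply: measurable_funV; exact: measurable_funM.
(* For fixed first coordinates y, the integral over the last one is folded to the half-line and then
   rewritten in [w] with q = |y|^2. *)
transitivity (\int[lebesgue_tuple R m]_t \int[leb R]_w (K (row_of_tuple t) w)%:E)%E.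
  rewrite (ge0_integral_tuple_rcons (F := fun t => (F (row_of_tuple t))%:E))//; last 2 first.
  - exact/measurable_EFinP.
  - by move=> t; rewrite lee_fin.
  apply: eq_integral => t _; set y := row_of_tuple t.
  under eq_integral do rewrite row_of_tuple_rcons -/y.
  rewrite ge0_integral_halfline; last 2 first.
  - have := measurableT_comp mF
      (measurableT_comp (@measurable_tuple_rcons R m) (pair1_measurable t)).
    by apply: eq_measurable_fun => a _ /=; rewrite row_of_tuple_rcons.
  - by [].
  rewrite -(ge0_integral_radial_substitution (G := G y) r0 p0 (sqr_ge0 (enorm y))); last 2 first.
  - move=> a a0 ra; apply: continuousM.
      apply: continuous_comp; last by apply: ck; rewrite rlt ?sqr_ge0.
      apply: continuous_comp; last exact: sqrt_continuous.
      by apply: cvgD; [exact: cvg_cst|exact: exprn_continuous].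
    apply: cvgD; first by apply: continuous_comp; [exact: crs|exact: cv].
    apply: continuous_comp; last exact: cv.
    apply: (@continuous_comp _ _ _ (fun a : R => - a)); [exact: opp_continuous|exact: crs].
  - by move=> a a0 ra; rewrite mulr_ge0 ?addr_ge0 ?k0// rlt ?sqr_ge0.
  apply: eq_integral => a _; congr EFin.
  case: (ltP 0 a) => //= a0; rewrite /F !enorm_snoc sqrrN rlt ?sqr_ge0//.
  by case: ifP; rewrite ?addr0// -mulrDr.
(* The order is exchanged because the scaling to come depends on [w]. *)
rewrite (fubini_tonelli (m1 := lebesgue_tuple R m) (m2 := leb R)
  (fun z : tuples R m * measurableTypeR R => (K (row_of_tuple z.1) z.2)%:E)); last 2 first.
- exact/measurable_EFinP.
- by move=> t; rewrite lee_fin.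
apply: eq_integral => w _ /=; rewrite /polar_integrand -/(l w).
case: (ltP 0 w) => w0 /=; last first.
  by apply: eq_integral => t _; rewrite /K ltNge w0.
have lw0 : 0 < l w by rewrite sqrtr_gt0 ltr_wpDr ?powR_ge0.
have mKw : measurable_fun setT (fun t : tuples R m => (K (row_of_tuple t) w)%:E).
  by apply/measurable_EFinP; exact: (measurableT_comp mK (pair2_measurable w)).
(* The condition D y w > 0 describes the ball of radius r l(w); scaling by l(w) brings it back to
   the ball of radius r. *)
rewrite (ge0_integral_tuple_scale (a := l w)
  (F := fun t => (K (row_of_tuple t) w)%:E)); last 3 first.
- by rewrite gt_eqF.
- exact: mKw.
- by move=> t; rewrite lee_fin.
have mKs := measurableT_comp mKw (@measurable_tuple_scale R m (l w)).
rewrite -ge0_integralZl//; last first.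
  by move=> t _; rewrite lee_fin.
apply: eq_integral => t _; rewrite -EFinM; congr EFin.
rewrite (gtr0_norm lw0) row_of_tuple_scale; set y := row_of_tuple t.
have DE : D (l w *: y) w = l w ^+ 2 * (r ^+ 2 - enorm y ^+ 2).
  rewrite /D enormZ (gtr0_norm lw0) exprMn mulrBr; congr (_ - _).
  by rewrite sqr_sqrtr 1?mulrC// addr_ge0// powR_ge0.
have sD : Num.sqrt (D (l w *: y) w) = l w * Num.sqrt (r ^+ 2 - enorm y ^+ 2).
  by rewrite DE sqrtrM ?sqr_ge0// sqrtr_sqr (gtr0_norm lw0).
rewrite /K w0/= sD DE pmulr_rgt0 ?exprn_gt0// subr_gt0.
rewrite ltr_pXn2r ?nnegrE ?enorm_ge0 ?ltW//.
case: ifPn => [yr|]; last by rewrite mulr0.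
have ry : 0 <= r ^+ 2 - enorm y ^+ 2.
  by rewrite subr_ge0 ltW// ltr_pXn2r ?nnegrE ?enorm_ge0// ltW.
congr (_ * _); rewrite /G; congr (k _ * _ * _).
  rewrite enormZ (gtr0_norm lw0) !exprMn -mulrDr (sqr_sqrtr ry).
  rewrite [enorm y ^+ 2 + _]addrC subrK sqrtrM ?sqr_ge0// !sqrtr_sqr.
  by rewrite (gtr0_norm lw0) (gtr0_norm r0) mulrC.
by rewrite /hemi_sum -(mulrN (l w)) !row_snocZ.
Qed.

(** * Finiteness of the integral of the area density *)

Lemma measurable_hemi_sum (R : realType) (m : nat) (v : 'rV[R]_m.+1 -> R) (r : R) :
  continuous v -> measurable_fun setT
    (fun z : measurableTypeR R * tuples R m => hemi_sum v r z.1 (row_of_tuple z.2)).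
Proof.
move=> /measurable_continuous_row mv.
have msc : measurable_fun setT
    (fun z : measurableTypeR R * tuples R m => tuple_scale z.1 z.2).
  apply/measurable_fun_tnthP => i /=.
  rewrite (_ : _ \o _ = fun z => z.1 * tnth z.2 i).
    apply: measurable_funM; first exact: measurable_fst.
    exact: measurableT_comp (measurable_tnth i) measurable_snd.
  by apply/funext => z /=; rewrite tnth_map.
have mh : measurable_fun setT (fun z : measurableTypeR R * tuples R m =>
    Num.sqrt (r ^+ 2 - enorm (row_of_tuple z.2) ^+ 2)).
  apply: measurable_fun_sqrt; apply: measurable_funB => //.
  by apply: measurable_funX; exact: measurableT_comp (@measurable_enorm R m) measurable_snd.
have mvh (h : measurableTypeR R * tuples R m -> R) : measurable_fun setT h ->
    measurable_fun setT (fun z : measurableTypeR R * tuples R m =>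
      v (z.1 *: @row_snoc R m.+1 (row_of_tuple z.2) (h z))).
  (* Moving the scaling inside [row_snoc] exhibits the argument of [v] as the row of a measurable
     tuple. *)
  move=> mh'; under eq_fun do rewrite -row_snocZ -row_of_tuple_scale -row_of_tuple_rcons.
  apply: (measurableT_comp mv).
  apply: (measurableT_comp (@measurable_tuple_rcons R m)).
  apply: measurable_fun_pair => //.
  by apply: measurable_funM => //; exact: measurable_fst.
by apply: measurable_funD; apply: mvh => //; exact: measurableT_comp mh.
Qed.

(** Up to the factor [r] this is the area density of either hemisphere, extended by 0 outside the
    ball so that integrals run over the whole space. *)
Definition inv_height (R : realType) (m : nat) (r : R) (y : 'rV[R]_m) : R :=
  if enorm y < r then (Num.sqrt (r ^+ 2 - enorm y ^+ 2))^-1 else 0.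

Lemma inv_height_ge0 (R : realType) (m : nat) (r : R) (y : 'rV[R]_m) : 0 <= inv_height r y.
Proof. by rewrite /inv_height; case: ifP => // _; rewrite invr_ge0 sqrtr_ge0. Qed.

Lemma measurable_inv_height (R : realType) (m : nat) (r : R) :
  measurable_fun setT (fun t : tuples R m => inv_height r (row_of_tuple t)).
Proof.
have me := @measurable_enorm R m.
apply: measurable_fun_ifT => //; first exact: measurable_fun_ltr.
apply: measurable_funV; apply: measurable_fun_sqrt; apply: measurable_funB => //.
exact: measurable_funX.
Qed.

Lemma measurable_polar (R : realType) (m : nat) (r p : R) (k : R -> R)
    (v : 'rV[R]_m.+1 -> R) :
  measurable_fun setT k -> continuous v ->
  measurable_fun setT (fun z : measurableTypeR R * tuples R m =>
    polar_integrand r p k v z.1 (row_of_tuple z.2)).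
Proof.
move=> mk cv; pose l (w : R) := Num.sqrt (1 + w `^ p).
have me : measurable_fun setT (fun z : measurableTypeR R * tuples R m =>
    enorm (row_of_tuple z.2)).
  exact: measurableT_comp (@measurable_enorm R m) measurable_snd.
have ml : measurable_fun setT (fun z : measurableTypeR R * tuples R m => l z.1).
  apply: measurable_fun_sqrt; apply: measurable_funD => //.
  exact: measurableT_comp (measurable_powR p) measurable_fst.
have mlt : measurable_fun setT (fun z : measurableTypeR R * tuples R m =>
    (l z.1 : measurableTypeR R, z.2)).
  exact: measurable_fun_pair ml measurable_snd.
apply: measurable_fun_ifT => //.
  by apply: measurable_and; apply: measurable_fun_ltr => //; exact: measurable_fst.
apply: measurable_funM; first exact: measurable_funX.
apply: measurable_funM.
  apply: measurable_funM.
    by apply: measurableT_comp mk _; exact: measurable_funM.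
  exact: measurableT_comp (measurable_hemi_sum r cv) mlt.
apply: measurable_funM.
  apply: measurable_funM => //; apply: measurable_funM => //.
  exact: measurableT_comp (measurable_powR (p - 1)) measurable_fst.
apply: measurable_funV; apply: measurable_funM => //; apply: measurable_funM => //.
apply: measurable_fun_sqrt; apply: measurable_funB => //.
exact: measurable_funX.
Qed.

Lemma ler_coord_enorm (R : realType) (m : nat) (y : 'rV[R]_m) (i : 'I_m) :
  `|y 0 i| <= enorm y.
Proof.
rewrite -sqrtr_sqr ler_wsqrtr// (bigD1 i)//= lerDl sumr_ge0// => j _.
exact: sqr_ge0.
Qed.

(** The polar formula is used with p = 1, v = 1 and the cut-off k(t) = max(0, 4 r^2 - t^2). Its left
    side is finite because k is bounded and vanishes beyond radius 2r; its right side is at least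
    r^4 times the integral in question, from the range 0 < w < 1 alone. *)
Lemma integral_inv_height_lty (R : realType) (m : nat) (r : R) : 0 < r ->
  (\int[lebesgue_tuple R m]_t (inv_height r (row_of_tuple t))%:E < +oo)%E.
Proof.
move=> r0; set X := integral _ _ _.
have X0 : (0 <= X)%E.
  by rewrite /X; apply: integral_ge0 => t _; rewrite lee_fin inv_height_ge0.
have r20 : 0 < r ^+ 2 by rewrite exprn_gt0.
pose k (t : R) := Num.max 0 (4 * r ^+ 2 - t ^+ 2).
have ck : continuous k.
  move=> t; apply: (@continuous_max _ _ (cst 0) (fun t : R => 4 * r ^+ 2 - t ^+ 2)).
    exact: cst_continuous.
  apply: cvgB; first exact: cvg_cst.
  exact: exprn_continuous.
have mk : measurable_fun setT k by exact: continuous_measurable_fun.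
have k0 t : 0 <= k t by rewrite le_max lexx.
have c1 : continuous (fun _ : 'rV[R]_m.+1 => 1 : R) by exact: cst_continuous.
have := @ge0_integral_polar R m r 1 k (fun=> 1) r0 ltr01 mk
  (fun t _ => ck t) (fun t _ => k0 t) c1 (fun=> ler01).
pose H (z : measurableTypeR R * tuples R m) :=
  polar_integrand r 1 k (fun=> 1) z.1 (row_of_tuple z.2).
have mH : measurable_fun setT H by exact: measurable_polar.
set L := integral _ _ _.
move=> LE.
have H0 z : 0 <= H z.
  rewrite /H /polar_integrand; case: ifP => // _; rewrite mulr_ge0 ?exprn_ge0 ?sqrtr_ge0//.
  rewrite mulr_ge0 ?divr_ge0 ?mulr_ge0 ?powR_ge0 ?sqrtr_ge0 ?exprn_ge0 ?(ltW r0)//.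
  by rewrite /hemi_sum addr_ge0.
have Llty : (L < +oo)%E.
  pose C := [set t : tuples R m.+1 | forall i, `|tnth t i| <= 2 * r].
  have mC : measurable C by exact: measurable_tuple_cube.
  have h4 : 0 <= 4 * r ^+ 2 by rewrite mulr_ge0// ltW.
  have r20' : 0 <= 2 * r by rewrite mulr_ge0// ltW.
  (* Outside the cube [C] some coordinate exceeds 2r in absolute value, hence so does the norm, and
     the cut-off is 0. *)
  apply: (@le_lt_trans _ _ (\int[lebesgue_tuple R m.+1]_(t in C) (4 * r ^+ 2)%:E)%E).
    rewrite [leRHS]integral_mkcond; apply: ge0_le_integral => //.
    - by move=> t _; rewrite lee_fin; case: ifP => // _; rewrite mulr1.
    - apply/measurable_EFinP; apply: measurable_fun_ifT => //.
        by apply: measurable_fun_ltr => //; exact: measurable_enorm.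
      by apply: measurable_funM => //; apply: measurableT_comp mk _; exact: measurable_enorm.
    - exact/(measurable_restrictT _ _).1.
    - move=> t _; rewrite patchE; case: (boolP (t \in C)) => [_|].
        rewrite lee_fin; case: ifP => _; last exact: h4.
        by rewrite mulr1 ge_max h4/= lerBlDr lerDl sqr_ge0.
      rewrite notin_setE => nC; rewrite lee_fin; case: ifP => // _.
      rewrite mulr1 ge_max lexx/= subr_le0.
      have [i Ci] : exists i, 2 * r < `|tnth t i|.
        by move/existsNP : nC => [i /negP]; rewrite -ltNge; exists i.
      rewrite (_ : 4 * r ^+ 2 = (2 * r) ^+ 2); last by ring.
      rewrite ler_pXn2r ?nnegrE ?enorm_ge0// (le_trans (ltW Ci))//.
      by have := ler_coord_enorm (row_of_tuple t) i; rewrite mxE.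
  have Cy : (lebesgue_tuple R m.+1 C < +oo)%E by rewrite lebesgue_tuple_cube// ltry.
  by rewrite integral_cst//; exact: lte_mul_pinfty.
(* The interval from 0 to 1 has length 1, so it is enough to bound the inner integral from below by
   r^4 X for each [w] in it. *)
have XL : ((r ^+ 4)%:E * X <= L)%E.
  rewrite LE -[leLHS]mule1.
  have -> : 1%E = leb R `]0, 1[ by rewrite lebesgue_measure_itv/= lte_fin ltr01 sube0.
  rewrite -integral_cst//.
  apply: (@le_trans _ _ (\int[leb R]_(w in `]0%R, 1%R[)
    \int[lebesgue_tuple R m]_t (H (w, t))%:E)%E); last first.
    apply: ge0_subset_integral => //.
      apply: (measurable_fun_fubini_tonelli_F (fun z => (H z)%:E)).
      - exact/measurable_EFinP.
      - by move=> z; rewrite lee_fin.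
    by move=> w _; apply: integral_ge0 => t _; rewrite lee_fin.
  apply: ge0_le_integral => //.
  - by move=> w _; rewrite mule_ge0// lee_fin exprn_ge0// ltW.
  - apply: measurable_funTS.
    apply: (measurable_fun_fubini_tonelli_F (fun z => (H z)%:E)).
    + exact/measurable_EFinP.
    + by move=> z; rewrite lee_fin.
  move=> w; rewrite /= in_itv/= => /andP[w0 w1].
  have mih := @measurable_inv_height R m r.
  rewrite /X -ge0_integralZl//; last 3 first.
  - exact/measurable_EFinP.
  - by move=> t _; rewrite lee_fin inv_height_ge0.
  - by rewrite lee_fin exprn_ge0// ltW.
  apply: ge0_le_integral => //.
  - by move=> t _; rewrite lee_fin mulr_ge0 ?inv_height_ge0 ?exprn_ge0// ltW.
  - by apply/measurable_EFinP; exact: measurable_funM.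
  - apply/measurable_EFinP; exact: (measurableT_comp mH (pair1_measurable w)).
  move=> t _; rewrite lee_fin /H /polar_integrand w0/= /inv_height.
  case: ifPn => [tr|_]; last by rewrite mulr0.
  have y2 : 0 < r ^+ 2 - enorm (row_of_tuple t) ^+ 2.
    by rewrite subr_gt0 ltr_pXn2r ?nnegrE ?enorm_ge0// ltW.
  have lE : Num.sqrt (1 + w `^ 1) ^+ 2 = 1 + w.
    by rewrite powRr1 ?ltW// sqr_sqrtr// addr_ge0// ltW.
  set l := Num.sqrt (1 + w `^ 1) in lE *.
  have l1 : 1 <= l.
    rewrite -(@ler_pXn2r _ 2)// ?nnegrE ?sqrtr_ge0// lE expr1n lerDl; exact: ltW.
  have l2 : l <= 2.
    by rewrite -(@ler_pXn2r _ 2)// ?nnegrE ?sqrtr_ge0// lE; lra.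
  have kl : 2 * r ^+ 2 <= k (r * l).
    by rewrite /k le_max; apply/orP; right; rewrite exprMn lE; nra.
  have l0 : 0 < l by exact: lt_le_trans l1.
  rewrite subrr powRr0 !mulr1 /hemi_sum.
  set h := Num.sqrt _; have h0 : 0 < h by rewrite sqrtr_gt0.
  (* For 0 < w < 1 one has l^2 = 1 + w <= 2, so k(r l) >= 2 r^2, and also 1 <= l <= 2. The product 2
     r^2 * 2 * r^2 / (4 h) is exactly r^4 / h. *)
  apply: (@le_trans _ _ (2 * r ^+ 2 * (1 + 1) * (r ^+ 2 / (2 * (2 * h))))).
    rewrite le_eqVlt; apply/orP; left; apply/eqP; field.
    by rewrite gt_eqF.
  apply: (@le_trans _ _ (k (r * l) * (1 + 1) * (r ^+ 2 / (2 * (l * h))))); last first.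
    rewrite ler_peMl ?exprn_ege1//; apply: mulr_ge0; first by rewrite mulr_ge0.
    by rewrite divr_ge0 ?mulr_ge0// ltW.
  apply: ler_pM => //.
  - by rewrite mulr_ge0// mulr_ge0// ltW.
  - by rewrite divr_ge0 ?mulr_ge0// ltW.
  - by rewrite ler_pM2r.
  rewrite ler_pM2l// lef_pV2 ?posrE ?mulr_gt0//.
  by rewrite ler_pM2l// ler_pM2r.
have r4 : (0 < r ^+ 4)%R by rewrite exprn_gt0.
rewrite ltNge leye_eq; apply/negP => /eqP Xy.
by move: (le_lt_trans XL Llty); rewrite Xy gt0_muley ?lte_fin// ltxx.
Qed.

(** * Limit of the radial average *)

Lemma Rintegral_dominated_cvg (d : measure_display) (T : measurableType d) (R : realType)
    (mu : {measure set T -> \bar R}) (f_ : nat -> T -> R) (f g : T -> R) :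
  (forall n, measurable_fun setT (f_ n)) -> measurable_fun setT f ->
  {ae mu, forall x, f_ n x @[n --> \oo] --> f x} ->
  mu.-integrable setT (EFin \o g) ->
  (forall n x, `|f_ n x| <= g x) ->
  (\int[mu]_x f_ n x)%R @[n --> \oo] --> (\int[mu]_x f x)%R.
Proof.
move=> mf_ mf ff ig fg.
have mf_' n : measurable_fun setT (fun x => (f_ n x)%:E) by exact/measurable_EFinP.
have mf' : measurable_fun setT (EFin \o f) by exact/measurable_EFinP.
have ff' : {ae mu, forall x, setT x -> (f_ n x)%:E @[n --> \oo] --> (f x)%:E}.
  apply: filterS ff => x h _; apply/fine_cvgP; split; first exact: nearW.
  exact: h.
have fg' : {ae mu, forall x n, setT x -> (`|(f_ n x)%:E| <= (EFin \o g) x)%E}.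
  by apply: aeW => x n _; rewrite lee_fin.
have [intf _ h] := dominated_convergence measurableT mf_' mf' ff' ig fg'.
apply: fine_cvg; rewrite /Rintegral fineK//.
exact: integrable_fin_num.
Qed.

Lemma cvg_powR_lt1 (R : realType) (w : R) (p : nat -> R) : 0 < w < 1 ->
  p n @[n --> \oo] --> +oo -> w `^ p n @[n --> \oo] --> 0.
Proof.
move=> /andP[w0 w1] py.
rewrite (_ : (fun n => _) = (fun x : R => expR (- x)) \o (fun n => p n * - ln w)); last first.
  by apply/funext => n /=; rewrite /powR gt_eqF// mulrN opprK.
apply: cvg_comp (@cvgr_expR R).
have lw : 0 < - ln w by rewrite oppr_gt0 ln_lt0// w0.
move/cvgryPge : py => py; apply/cvgryPge => A.
by apply: filterS (py (A / - ln w)) => n; rewrite ler_pdivrMr.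
Qed.

Lemma integrable_inv_oneDsqr (R : realType) (M : R) :
  (leb R).-integrable setT
    (EFin \o (fun w : R => if 0 <= w then M / (1 + w ^+ 2) else 0)).
Proof.
have i0 : (leb R).-integrable `[0%R, +oo[ (fun w => M%:E * (oneDsqr w)^-1%:E)%E.
  apply: integrableZl => //; apply/integrableP; split.
    apply/measurable_EFinP; apply: measurable_funTS.
    by apply: continuous_measurable_fun; exact: continuous_oneDsqrV.
  apply: (@le_lt_trans _ _ (\int[leb R]_(w in `[0%R, +oo[) (oneDsqr w)^-1%:E)%E).
    rewrite le_eqVlt; apply/orP; left; apply/eqP.
    by apply: eq_integral => w _; rewrite gee0_abs// lee_fin invr_ge0 addr_ge0 ?sqr_ge0.
  by rewrite integral0y_oneDsqr ltry.
have -> : EFin \o (fun w : R => if 0 <= w then M / (1 + w ^+ 2) else 0) =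
    (fun w => M%:E * (oneDsqr w)^-1%:E)%E \_ `[0%R, +oo[.
  apply/funext => w; rewrite patchE mem_setE in_itv/= andbT.
  by case: ifP.
by rewrite -integrable_mkcond.
Qed.

(** The majorant does not depend on [p]. If w <= 1 then 1 + w^2 <= 2, which accounts for the factor
    2; if w > 1 then w^2 <= w^p because p >= 2. *)
Lemma radial_weight_le (R : realType) (a M p w : R) : 2 <= p -> 0 <= a <= M ->
  `|if 0 < w then a / (1 + w `^ p) else 0| <= (if 0 <= w then 2 * M / (1 + w ^+ 2) else 0).
Proof.
move=> p2 /andP[g0 gm]; have M0 := le_trans g0 gm.
case: ifPn => w0; last first.
  by rewrite normr0; case: ifP => // _; rewrite divr_ge0 ?mulr_ge0 ?addr_ge0 ?sqr_ge0.
rewrite (ltW w0) ger0_norm; last by rewrite divr_ge0 ?addr_ge0 ?powR_ge0.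
have P0 : 0 < w `^ p by rewrite powR_gt0.
have W0 : 0 < w ^+ 2 by rewrite exprn_gt0.
rewrite mulrAC [X in _ <= X]mulrC ler_pM ?invr_ge0 ?addr_ge0 ?powR_ge0//.
rewrite ler_pdivlMr ?addr_gt0// mulrC ler_pdivrMr ?addr_gt0//.
have [w1|w1] := leP w 1.
  by have : w ^+ 2 <= 1 by [rewrite expr_le1// ltW]; nra.
have : w ^+ 2 <= w `^ p.
  by rewrite -(powR_mulrn _ (ltW w0)) ler_powR// ltW.
by nra.
Qed.

(* The weight [1 / (1 + w^p)] tends to the indicator of [0 < w < 1], where
   [sqrt (1 + w^p)] tends to [1]. *)
Lemma cvg_radial_average (R : realType) (g : R -> R) (M : R) (p : nat -> R) :
  measurable_fun setT g -> (forall l, 0 <= g l <= M) ->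
  (forall l : nat -> R, l n @[n --> \oo] --> (1 : R) -> g (l n) @[n --> \oo] --> g 1) ->
  (forall n, 2 <= p n) -> p n @[n --> \oo] --> +oo ->
  (\int[leb R]_w (if (0 < w)%R then g (Num.sqrt (1 + w `^ p n)) / (1 + w `^ p n) else 0))%R
    @[n --> \oo] --> g 1.
Proof.
move=> mg gM cg p2 py.
have M0 : 0 <= M by have /andP[h1 h2] := gM 0; exact: le_trans h2.
pose lim (w : R) := if (0 < w) && (w < 1) then g 1 else 0.
have -> : g 1 = (\int[leb R]_w lim w)%R.
  transitivity (\int[leb R]_(w in `]0%R, 1%R[) g 1)%R.
    by rewrite Rintegral_cst//= lebesgue_measure_itv/= lte_fin ltr01 sube0 mulr1.
  rewrite Rintegral_mkcond; apply: eq_Rintegral => w _.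
  by rewrite patchE mem_setE in_itv.
have mpow a : measurable_fun setT (fun w : R => w `^ a) by exact: measurable_powR.
apply: (@Rintegral_dominated_cvg _ _ R (leb R) _ lim
  (fun w : R => if 0 <= w then 2 * M / (1 + w ^+ 2) else 0)).
- move=> n; have mw : measurable_fun setT (fun w : R => 1 + w `^ p n) by exact: measurable_funD.
  apply: measurable_fun_ifT => //; first exact: measurable_fun_ltr.
  apply: measurable_funM; last exact: measurable_funV.
  by apply: measurableT_comp mg _; exact: measurable_fun_sqrt.
- apply: measurable_fun_ifT => //.
  by apply: measurable_and; exact: measurable_fun_ltr.
(* At w = 1 the weight is 1/2 for every n, so this point is excluded as a null set. *)
- exists [set (1 : R)]; split => //; first exact: lebesgue_measure_set1.
  apply: subsetC2; rewrite setCK => w /= /eqP w1.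
  rewrite /lim; case: (ltP 0 w) => w0 /=; last exact: cvg_cst.
  case: ltgtP w1 => // w1 _.
    have pw := cvg_powR_lt1 (w := w) (p := p).
    have {}pw : 1 + w `^ p n @[n --> \oo] --> 1 + (0 : R).
      by apply: cvgD; [exact: cvg_cst|apply: pw => //; rewrite w0].
    rewrite addr0 in pw; rewrite -[X in _ --> X]divr1; apply: cvgM; last first.
      by apply: cvgV => //; rewrite oner_eq0.
    apply: cg; rewrite -[X in _ --> X]sqrtr1.
    by apply: continuous_cvg => //; exact: sqrt_continuous.
  (* For w > 1 the integrand is squeezed between 0 and M (1/w)^p, a power with base below 1. *)
  have pw : M * w^-1 `^ p n @[n --> \oo] --> M * 0.
    apply: cvgM; first exact: cvg_cst.
    by apply: cvg_powR_lt1 => //; rewrite invr_gt0 w0/= invf_lt1.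
  rewrite mulr0 in pw; apply: squeeze_cvgr (cvg_cst 0) pw.
  apply: nearW => n; have /andP[g0 gm] := gM (Num.sqrt (1 + w `^ p n)).
  have P0 : 0 < w `^ p n by rewrite powR_gt0.
  rewrite divr_ge0 ?addr_ge0 ?powR_ge0//= ler_pM ?invr_ge0 ?addr_ge0 ?powR_ge0//.
  rewrite -(powR_inv1 (ltW w0)) powRAC powR_inv1 ?powR_ge0// lef_pV2 ?posrE ?addr_gt0//.
  by rewrite lerDr.
- exact: integrable_inv_oneDsqr.
by move=> n w; exact: radial_weight_le.
Qed.

(** * Integrals over spheres as functions of the radius *)

(** For l > 0 this is the surface integral of [v] over the sphere of radius [r * l] centred at the
    origin, divided by [r * l ^+ m]. *)
Definition hemi_integral (R : realType) (m : nat) (v : 'rV[R]_m.+1 -> R) (r l : R) : R :=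
  (\int[lebesgue_tuple R m]_t
    (hemi_sum v r l (row_of_tuple t) * inv_height r (row_of_tuple t)))%R.

Lemma integrable_inv_height (R : realType) (m : nat) (r : R) : 0 < r ->
  (lebesgue_tuple R m).-integrable setT (fun t => (inv_height r (row_of_tuple t))%:E).
Proof.
move=> r0; apply/integrableP; split.
  by apply/measurable_EFinP; exact: measurable_inv_height.
apply: le_lt_trans (integral_inv_height_lty m r0).
rewrite le_eqVlt; apply/orP; left; apply/eqP; apply: eq_integral => t _.
by rewrite gee0_abs// lee_fin inv_height_ge0.
Qed.

Section hemi_integral.
Context (R : realType) (m : nat) (v : 'rV[R]_m.+1 -> R) (r C : R).
Hypotheses (r0 : 0 < r) (cv : continuous v) (v0 : forall y, 0 <= v y) (vC : forall y, v y <= C).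

Let f (l : R) (t : tuples R m) := hemi_sum v r l (row_of_tuple t) * inv_height r (row_of_tuple t).

Let f0 l t : 0 <= f l t.
Proof. by rewrite mulr_ge0 ?inv_height_ge0// addr_ge0. Qed.

Let fC l t : f l t <= 2 * C * inv_height r (row_of_tuple t).
Proof.
rewrite ler_wpM2r ?inv_height_ge0// mulrDl mul1r.
by rewrite lerD.
Qed.

Let mf : measurable_fun setT (fun z : measurableTypeR R * tuples R m => f z.1 z.2).
Proof.
apply: measurable_funM; first exact: measurable_hemi_sum.
exact: measurableT_comp (@measurable_inv_height R m r) measurable_snd.
Qed.

Let mfl l : measurable_fun setT (f l).
Proof. exact: measurableT_comp mf (pair1_measurable l). Qed.

(** This majorant is independent of [l]: it yields the finiteness of every [hemi_integral], a common
    bound for them, and dominated convergence as l tends to 1. *)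
Let iC : (lebesgue_tuple R m).-integrable setT
  (EFin \o (fun t => 2 * C * inv_height r (row_of_tuple t))).
Proof.
rewrite (_ : _ \o _ = fun t => ((2 * C)%:E * (inv_height r (row_of_tuple t))%:E)%E)//.
by apply: integrableZl => //; exact: integrable_inv_height.
Qed.

Lemma integrable_hemi_sum l : (lebesgue_tuple R m).-integrable setT (EFin \o f l).
Proof.
apply: le_integrable iC => //; first exact/measurable_EFinP.
by move=> t _; rewrite /= lee_fin (ger0_norm (f0 l t)) (le_trans (fC l t))// ler_norm.
Qed.

Lemma hemi_integralE l : (hemi_integral v r l)%:E = (\int[lebesgue_tuple R m]_t (f l t)%:E)%E.
Proof.
rewrite /hemi_integral /Rintegral fineK//.
exact: integrable_fin_num (integrable_hemi_sum l).
Qed.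

Lemma hemi_integral_bounded l :
  0 <= hemi_integral v r l <=
    (\int[lebesgue_tuple R m]_t (2 * C * inv_height r (row_of_tuple t)))%R.
Proof.
apply/andP; split; first by apply: Rintegral_ge0 => t _; exact: f0.
by apply: (le_Rintegral measurableT (integrable_hemi_sum l) iC) => t _; exact: fC.
Qed.

Lemma measurable_hemi_integral : measurable_fun setT (hemi_integral v r).
Proof.
apply/measurable_EFinP.
rewrite (_ : _ \o _ = fun l => (\int[lebesgue_tuple R m]_t (f l t)%:E)%E); last first.
  by apply/funext => l; exact: hemi_integralE.
apply: (measurable_fun_fubini_tonelli_F (fun z : measurableTypeR R * tuples R m => (f z.1 z.2)%:E)).
  exact/measurable_EFinP.
by move=> z; rewrite lee_fin.
Qed.

Lemma cvg_hemi_integral (l : nat -> R) : l n @[n --> \oo] --> (1 : R) ->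
  hemi_integral v r (l n) @[n --> \oo] --> hemi_integral v r 1.
Proof.
move=> l1; apply: (Rintegral_dominated_cvg (f := f 1) (fun n => mfl (l n)) (mfl 1) _ iC) => //.
  apply: aeW => t; apply: cvgM; last exact: cvg_cst.
  have cZ (y : 'rV[R]_m.+1) : v (l n *: y) @[n --> \oo] --> v (1 *: y).
    apply: continuous_cvg; first exact: cv.
    by apply: cvgZ => //; exact: cvg_cst.
  by apply: cvgD; exact: cZ.
by move=> n t; rewrite ger0_norm//; exact: fC.
Qed.

End hemi_integral.

(** * The kernel integral in polar form *)

Lemma Gamma_ge0 (R : realType) (t : R) : 0 <= Gamma t.
Proof. by apply: Rintegral_ge0 => x _; rewrite mulr_ge0 ?powR_ge0 ?expR_ge0. Qed.

Lemma c_ns_ge0 (R : realType) (n : nat) (s : R) : 0 < s < 1 -> 0 <= c_ns n s.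
Proof.
move=> /andP[s0 s1]; rewrite /c_ns divr_ge0 ?powR_ge0// mulr_ge0 ?Gamma_ge0//.
have p0 := pi_ge0 R.
by rewrite sin_ge0_pi// mulr_ge0 ?(ltW s0)//= ler_piMr// ltW.
Qed.

(** On the sphere of radius r l one has |y|^2 - r^2 = r^2 w^p, so the singular factor is r^(2s)
    w^(ps): its first part cancels the numerator of the kernel and its second the Jacobian w^(p-1).
    The bound s >= 1/2 means p >= 2, which makes the remaining integral finite. *)
Lemma integral_A_kernel (R : realType) (m : nat) (v : 'rV[R]_m.+1 -> R) (r C s : R) :
  0 < r -> continuous v -> (forall y, 0 <= v y) -> (forall y, v y <= C) -> 2^-1 <= s < 1 ->
  let p := (1 - s)^-1 in
  (\int[lebesgue_tuple R m.+1]_t (A_kernel s r (row_of_tuple t) * v (row_of_tuple t))%:E)%E =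
  (c_ns m.+1 s * p * (r ^+ 2 / (2 * r ^+ m.+1)) *
   (\int[leb R]_w (if (0 < w)%R then
      hemi_integral v r (Num.sqrt (1 + w `^ p)) / (1 + w `^ p) else 0))%R)%:E.
Proof.
move=> r0 cv v0 vC /andP[s2 s1] p.
have s0 : 0 < s by exact: lt_le_trans s2.
have s01 : 0 < s < 1 by rewrite s0.
have p0 : 0 < p by rewrite invr_gt0 subr_gt0.
have p2 : 2 <= p.
  by rewrite /p -[leLHS]invrK lef_pV2 ?posrE ?subr_gt0//; lra.
have c0 := c_ns_ge0 m.+1 s01.
pose k (t : R) := c_ns m.+1 s * (r `^ (2 * s) / ((t ^+ 2 - r ^+ 2) `^ s * t ^+ m.+1)).
have mexp n : measurable_fun setT (fun t : R => t ^+ n).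
  by apply: continuous_measurable_fun; exact: exprn_continuous.
have mk : measurable_fun setT k.
  apply: measurable_funM => //; apply: measurable_funM => //.
  apply: measurable_funV; apply: measurable_funM => //.
  by apply: measurableT_comp (measurable_powR s) _; exact: measurable_funB.
have tr t : r < t -> 0 < t ^+ 2 - r ^+ 2.
  move=> rt; rewrite subr_gt0 ltr_pXn2r ?nnegrE ?ltW//.
  exact: lt_trans rt.
have ck t : r < t -> {for t, continuous k}.
  move=> rt; have t0 : 0 < t by exact: lt_trans rt.
  apply: continuousM; first exact: cst_continuous.
  apply: continuousM; first exact: cst_continuous.
  apply: continuousV; first by rewrite gt_eqF// mulr_gt0 ?exprn_gt0// powR_gt0// tr.
  apply: continuousM; last exact: exprn_continuous.
  apply: (@continuous_comp _ _ _ (fun t : R => t ^+ 2 - r ^+ 2) (fun x => x `^ s)); last first.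
    by apply: continuous_powR; exact: tr.
  by apply: cvgB; [exact: exprn_continuous|exact: cvg_cst].
have k0 t : r < t -> 0 <= k t.
  move=> rt; have t0 : 0 < t by exact: lt_trans rt.
  by rewrite mulr_ge0// divr_ge0 ?mulr_ge0 ?powR_ge0// exprn_ge0// ltW.
rewrite [LHS](_ : _ = \int[lebesgue_tuple R m.+1]_t
    (if r < enorm (row_of_tuple t) then
       k (enorm (row_of_tuple t)) * v (row_of_tuple t) else 0)%:E)%E; last first.
  apply: eq_integral => t _; congr EFin; rewrite /A_kernel; case: ifP => //.
  by rewrite mul0r.
rewrite (ge0_integral_polar (p := p))//.
set K := c_ns _ _ * _ * _.
have pE (w : R) (y : 'rV[R]_m) : polar_integrand r p k v w y =
    K * (if 0 < w then
      hemi_sum v r (Num.sqrt (1 + w `^ p)) y * inv_height r y / (1 + w `^ p) else 0).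
  rewrite /polar_integrand; case: (ltP 0 w) => w0 /=; last by rewrite mulr0.
  rewrite /inv_height; case: ltP => yr; last by rewrite mulr0 mul0r mulr0.
  have y2 : 0 < r ^+ 2 - enorm y ^+ 2.
    by rewrite subr_gt0 ltr_pXn2r ?nnegrE ?enorm_ge0// ltW.
  have lE : Num.sqrt (1 + w `^ p) ^+ 2 = 1 + w `^ p.
    by rewrite sqr_sqrtr// addr_ge0// powR_ge0.
  set l := Num.sqrt (1 + w `^ p) in lE *.
  have l0 : 0 < l by rewrite sqrtr_gt0 ltr_wpDr// powR_ge0.
  (* This is p (1 - s) = 1, the choice of [p]. *)
  have ps : p - 1 = p * s.
    by rewrite -[X in _ - X](mulVf (_ : 1 - s != 0)) ?gt_eqF ?subr_gt0// -/p; ring.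
  have rlE : ((r * l) ^+ 2 - r ^+ 2) `^ s = r `^ (2 * s) * w `^ (p * s).
    rewrite exprMn lE mulrDr mulr1 addrC addKr powRM ?exprn_ge0 ?powR_ge0 ?ltW//.
    by rewrite -powR_mulrn ?ltW// -!powRrM.
  rewrite /k rlE ps -lE /K exprMn; set h := Num.sqrt _.
  have h0 : 0 < h by rewrite sqrtr_gt0.
  have W0 : 0 < w `^ (p * s) by rewrite powR_gt0.
  have R0 : 0 < r `^ (2 * s) by rewrite powR_gt0.
  (* The powers of [l] combine to l^m / (l^(m+1) l) = 1 / l^2 = 1 / (1 + w^p). *)
  rewrite [l ^+ m.+1]exprS; set rm := r ^+ m.+1; set lm := l ^+ m.
  have rm0 : 0 < rm by rewrite exprn_gt0.
  have lm0 : 0 < lm by rewrite exprn_gt0.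
  by field; rewrite !gt_eqF.
have K0 : 0 <= K.
  apply: mulr_ge0; first by rewrite mulr_ge0// ltW.
  by rewrite divr_ge0 ?mulr_ge0 ?exprn_ge0// ltW.
pose G (w : R) := if 0 < w then hemi_integral v r (Num.sqrt (1 + w `^ p)) / (1 + w `^ p) else 0.
have mG : measurable_fun setT G.
  have mw : measurable_fun setT (fun w : R => 1 + w `^ p).
    by apply: measurable_funD => //; exact: measurable_powR.
  apply: measurable_fun_ifT => //; first exact: measurable_fun_ltr.
  apply: measurable_funM; last exact: measurable_funV.
  apply: measurableT_comp (measurable_hemi_integral r0 cv v0 vC) _.
  exact: measurable_fun_sqrt.
have G0 w : 0 <= G w.
  rewrite /G; case: ifP => // _; rewrite divr_ge0 ?addr_ge0 ?powR_ge0//.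
  by have /andP[] := hemi_integral_bounded r0 cv v0 vC (Num.sqrt (1 + w `^ p)).
(* Integrability lets the real-valued integral on the right be read as an extended one; otherwise
   [Rintegral] could hide an infinite value. *)
have iG : (leb R).-integrable setT (EFin \o G).
  apply: le_integrable (integrable_inv_oneDsqr _) => //; first exact/measurable_EFinP.
  move=> w _; rewrite /= lee_fin.
  apply: le_trans (ler_norm _); apply: radial_weight_le p2 _.
  exact: hemi_integral_bounded r0 cv v0 vC _.
rewrite EFinM /Rintegral fineK; last exact: integrable_fin_num iG.
rewrite -ge0_integralZl//; last 2 first.
- exact/measurable_EFinP.
- by move=> w _; rewrite lee_fin; exact: G0.
apply: eq_integral => w _; rewrite -EFinM /G.
under eq_integral do rewrite pE.
case: (ltP 0 w) => w0; last first.
  by under eq_integral do rewrite mulr0; rewrite mulr0 integral0.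
have b0 : 0 <= K / (1 + w `^ p) by rewrite divr_ge0 ?addr_ge0 ?powR_ge0.
have mf : measurable_fun setT (fun t : tuples R m => (hemi_sum v r
    (Num.sqrt (1 + w `^ p)) (row_of_tuple t) * inv_height r (row_of_tuple t))%:E).
  apply/measurable_EFinP; apply: measurable_funM; last exact: measurable_inv_height.
  exact: (measurableT_comp (measurable_hemi_sum r cv) (pair1_measurable _)).
rewrite mulrA mulrAC EFinM (hemi_integralE r0 cv v0 vC) -ge0_integralZl//; last first.
  by move=> t _; rewrite lee_fin mulr_ge0 ?inv_height_ge0// addr_ge0.
apply: eq_integral => t _; rewrite -EFinM; congr EFin.
by rewrite mulrA mulrAC.
Qed.

(** * Area density of a hemisphere *)

(** Reduces partial derivatives to the calculus of functions of one real variable. *)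
Lemma derive_line (R : realType) (V : normedModType R) (f : V -> R) (a v : V) (d : R) :
  is_derive (0 : R) (1 : R) (fun h => f (h *: v + a)) d -> 'D_v f a = d.
Proof.
move=> [_ <-]; rewrite /derive.
set f1 := (X in lim (X @ _)); set f2 := (X in _ = lim (X @ _)).
suff -> : f1 = f2 by [].
apply/funext => h; rewrite /f1 /f2 /=.
by rewrite !addr0 scale0r add0r [h *: 1]mulr1.
Qed.

(** Matrix determinant lemma: one block matrix is factored in two ways, through the Schur complement
    of either diagonal block, and the determinants are compared. *)
Lemma det_rank1 (R : comNzRingType) (m : nat) (u : 'rV[R]_m) :
  \det (1%:M + u^T *m u) = 1 + \sum_i u 0 i ^+ 2.
Proof.
have E1 : block_mx 1%:M u (- u^T) 1%:M =
    block_mx 1%:M 0 (- u^T) 1%:M *m block_mx (1%:M : 'M[R]_1) u 0 (1%:M + u^T *m u).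
  rewrite mulmx_block !mul1mx !mul0mx !mulmx1 !addr0.
  by rewrite mulNmx addrCA addNr addr0.
have E2 : block_mx 1%:M u (- u^T) 1%:M =
    block_mx (1%:M + u *m u^T) u 0 1%:M *m block_mx (1%:M : 'M[R]_1) 0 (- u^T) 1%:M.
  rewrite mulmx_block !mul1mx !mul0mx !mulmx1 !mulmx0 !add0r.
  by rewrite mulmxN addrK.
transitivity (\det (1%:M + u *m u^T)).
  have := congr1 determinant E1; rewrite {1}E2 !det_mulmx !det_lblock !det_ublock !det1.
  by rewrite !mul1r !mulr1.
rewrite det_mx11 !mxE eqxx; congr (_ + _); apply: eq_bigr => i _.
by rewrite mxE expr2.
Qed.

Lemma enorm_delta_line (R : realType) (m : nat) (y : 'rV[R]_m) (i : 'I_m) (h : R) :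
  enorm (h *: delta_mx 0 i + y) ^+ 2 = enorm y ^+ 2 + (2 * y 0 i * h + h ^+ 2).
Proof.
rewrite !enorm_sqr [in RHS](bigD1 i)//= (bigD1 i)//= !mxE !eqxx/= mulr1.
rewrite (eq_bigr (fun j => y 0 j ^+ 2)); last first.
  by move=> j /negPf ji; rewrite !mxE ji andbF mulr0 add0r.
by ring.
Qed.

(** Only the last coordinate is nonlinear. Along a coordinate line the squared norm is a quadratic
    polynomial, and enorm y < r keeps the argument of the square root positive at the base point. *)
Lemma partial_hemisphere (R : realType) (m : nat) (x : 'rV[R]_m.+1) (r sgn : R)
    (y : 'rV[R]_m) (i : 'I_m) (k : 'I_m.+1) : enorm y < r ->
  partial i (fun z : 'rV[R]_m => @hemisphere R m.+1 x r sgn z 0 k) y =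
  if insub (k : nat) is Some j then (i == j)%:R
  else - sgn * y 0 i / Num.sqrt (r ^+ 2 - enorm y ^+ 2).
Proof.
move=> yr; apply: derive_line; rewrite /hemisphere.
have r0 : 0 < r by apply: le_lt_trans yr; exact: enorm_ge0.
have y2 : 0 < r ^+ 2 - enorm y ^+ 2.
  by rewrite subr_gt0 ltr_pXn2r ?nnegrE ?enorm_ge0// ltW.
under eq_fun do rewrite !mxE.
case: insubP => [j _ _|_].
  rewrite (_ : (fun _ => _) = cst (x 0 k + y 0 j) + (i == j)%:R \*: id).
    have := is_deriveD (is_derive_cst (x 0 k + y 0 j) (0 : R) (1 : R))
      (is_deriveZ ((i == j)%:R : R) (is_derive_id (0 : R) (1 : R))).
    by rewrite add0r [_ *: 1]mulr1.
  apply/funext => h /=; rewrite !mxE eqxx/= eq_sym.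
  transitivity (x 0 k + y 0 j + (i == j)%:R * h); last by [].
  by ring.
pose D h := r ^+ 2 - (enorm y ^+ 2 + (2 * y 0 i * h + h ^+ 2)).
have D0 : D 0 = r ^+ 2 - enorm y ^+ 2 by rewrite /D mulr0 expr0n/= !addr0.
have dD : is_derive (0 : R) (1 : R) D (- (2 * y 0 i)).
  have := is_deriveB (is_derive_cst (r ^+ 2) (0 : R) (1 : R))
    (is_deriveD (is_derive_cst (enorm y ^+ 2) (0 : R) (1 : R))
       (is_deriveD (is_deriveZ (2 * y 0 i) (is_derive_id (0 : R) (1 : R)))
         (is_deriveX 2 (is_derive_id (0 : R) (1 : R))))).
  by rewrite sub0r add0r mulr0 scale0r addr0 [_ *: 1]mulr1.
have D0p : 0 < D 0 by rewrite D0.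
have dS := @is_derive1_comp _ _ _ (0 : R) _ _ (is_derive1_sqrt D0p) dD.
have := is_deriveD (is_derive_cst (x 0 k) (0 : R) (1 : R)) (is_deriveZ sgn dS).
rewrite add0r D0 => dF.
rewrite (_ : _ / _ =
    sgn *: ((2 * Num.sqrt (r ^+ 2 - enorm y ^+ 2))^-1 * - (2 * y 0 i))); last first.
  rewrite /GRing.scale/=; field.
  by rewrite gt_eqF// sqrtr_gt0.
rewrite (_ : (fun _ => _) = cst (x 0 k) + sgn \*: (Num.sqrt \o D))//.
by apply/funext => h; rewrite enorm_delta_line.
Qed.

(** The height h over y has gradient -y / h, so the Gram matrix is the identity plus the rank-one
    matrix of u = y / h. Its determinant is 1 + |y|^2 / h^2 = r^2 / h^2. *)
Lemma area_density_hemisphere (R : realType) (m : nat) (x : 'rV[R]_m.+1) (r sgn : R)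
    (y : 'rV[R]_m) : sgn ^+ 2 = 1 -> enorm y < r ->
  area_density (@hemisphere R m.+1 x r sgn) y = r / Num.sqrt (r ^+ 2 - enorm y ^+ 2).
Proof.
move=> s2 yr.
have r0 : 0 < r by apply: le_lt_trans yr; exact: enorm_ge0.
have y2 : 0 < r ^+ 2 - enorm y ^+ 2.
  by rewrite subr_gt0 ltr_pXn2r ?nnegrE ?enorm_ge0// ltW.
set h := Num.sqrt _.
have h2 : h ^+ 2 = r ^+ 2 - enorm y ^+ 2 by rewrite sqr_sqrtr// ltW.
have h0 : 0 < h by rewrite sqrtr_gt0.
pose u : 'rV[R]_m := h^-1 *: y.
rewrite /area_density /=.
rewrite (_ : (\matrix_(i, j) _) = 1%:M + u^T *m u); last first.
  apply/matrixP => i j; rewrite !mxE big_ord_recr/= !partial_hemisphere//.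
  rewrite !insubF ?ltnn// big_ord1 !mxE -/h; congr (_ + _).
    rewrite (eq_bigr (fun k : 'I_m => (i == k)%:R * (j == k)%:R)); last first.
      move=> k _; rewrite !partial_hemisphere//.
      case: insubP => [k' _ kk'|]; last by rewrite /= ltn_ord.
      by rewrite (_ : k' = k)//; exact: val_inj.
    rewrite (bigD1 i)//= eqxx mul1r big1 ?addr0 1?eq_sym// => k /negPf ki.
    by rewrite eq_sym ki mul0r.
  transitivity (sgn ^+ 2 * (h^-1 * y 0 i * (h^-1 * y 0 j))); last by rewrite s2 mul1r.
  by ring.
rewrite det_rank1.
transitivity (Num.sqrt ((r / h) ^+ 2)); last by rewrite sqrtr_sqr ger0_norm// divr_ge0// ltW.
congr Num.sqrt; under eq_bigr do rewrite mxE exprMn.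
rewrite -mulr_sumr -enorm_sqr exprMn exprVn h2.
by field; rewrite gt_eqF.
Qed.

(** * The limit along sequences, for nonnegative functions *)

(** Since sin pi = 0, this is minus the difference quotient of sin(pi s) at s = 1, where the
    derivative is pi cos pi = -pi. *)
Lemma cvg_sin_pi_div (R : realType) (u : nat -> R) :
  (forall n, u n < 1) -> u n @[n --> \oo] --> (1 : R) ->
  sin (pi * u n) / (1 - u n) @[n --> \oo] --> (pi : R).
Proof.
move=> u1 uc.
have dl : is_derive (1 : R) (1 : R) (fun s : R => pi * s) pi.
  have := is_deriveZ (pi : R) (is_derive_id (1 : R) (1 : R)).
  by rewrite [_ *: 1]mulr1.
have [df dE] := is_derive1_comp (is_derive_sin (pi * 1)) dl.
have := df; rewrite /derivable => /cvg_ex[/= l dfl].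
have lE : l = - pi.
  have := cvg_lim (@Rhausdorff R) dfl; rewrite -[lim _]/('D_1 (sin \o (fun s : R => pi * s)) 1) dE.
  by rewrite mulr1 cospi mulN1r => <-.
move: dfl; rewrite lE => /cvgr_dnbhsP/(_ (fun n => u n - 1)) h.
have hu : (forall n, u n - 1 != 0) /\ (u n - 1 @[n --> \oo] --> (0 : R)).
  split; first by move=> n; rewrite subr_eq0 lt_eqF.
  by rewrite -(subrr (1 : R)); apply: cvgB => //; exact: cvg_cst.
rewrite -[X in _ --> X]opprK.
apply: cvg_trans (cvgN (h hu)).
apply: near_eq_cvg; apply: nearW => n /=.
rewrite /GRing.scale/= ?fctE /= (mulr1 (u n - 1)) subrK mulr1 sinpi subr0 -mulNr -invrN opprB.
by rewrite mulrC.
Qed.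

Lemma cvg_A_kernel_seq (R : realType) (m : nat) (v : 'rV[R]_m.+1 -> R) (r C : R) (u : nat -> R) :
  0 < r -> continuous v -> (forall y, 0 <= v y) -> (forall y, v y <= C) ->
  (forall n, 2^-1 <= u n < 1) -> u n @[n --> \oo] --> (1 : R) ->
  (\int[lebesgue_tuple R m.+1]_t (A_kernel (u n) r (row_of_tuple t) * v (row_of_tuple t)))%R
    @[n --> \oo] --> (sphere_area R m.+1 * r ^+ m)^-1 * (r * hemi_integral v r 1).
Proof.
move=> r0 cv v0 vC u21 uc.
have u1 n : u n < 1 by have /andP[] := u21 n.
have -> : (sphere_area R m.+1 * r ^+ m)^-1 * (r * hemi_integral v r 1) =
    pi * (Gamma (m.+1%:R / 2) / pi `^ (m.+1%:R / 2 + 1)) *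
    (r ^+ 2 / (2 * r ^+ m.+1)) * hemi_integral v r 1.
  have p0 := pi_gt0 R.
  rewrite /sphere_area powRD ?gt_eqF ?implybT// powRr1 ?ltW// !invfM invrK [r ^+ m.+1]exprS.
  have P0 : 0 < (pi : R) `^ (m.+1%:R / 2) by rewrite powR_gt0.
  have rm0 : 0 < r ^+ m by rewrite exprn_gt0.
  (* Once the inverse of the area is expanded, Gamma stands in the numerator on both sides, so
     [field] asks only the other factors to be nonzero. *)
  move: P0 rm0 p0; move: (pi `^ (m.+1%:R / 2)) (Gamma _) (r ^+ m) (hemi_integral v r 1).
  move: (pi : R) => q P G rm H P0 rm0 p0.
  by field; rewrite !gt_eqF.
under eq_fun do rewrite /Rintegral (integral_A_kernel r0 cv v0 vC (u21 _)) /=.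
apply: cvgM.
  apply: cvgM; last exact: cvg_cst.
  rewrite (_ : (fun _ => _) = fun n => sin (pi * u n) / (1 - u n) *
      (Gamma (m.+1%:R / 2) / pi `^ (m.+1%:R / 2 + 1))).
    by apply: cvgM; [exact: cvg_sin_pi_div|exact: cvg_cst].
  by apply/funext => n; rewrite /c_ns [RHS]mulrA [LHS]mulrAC; congr (_ * _); exact: mulrAC.
apply: (cvg_radial_average (measurable_hemi_integral r0 cv v0 vC)
  (hemi_integral_bounded r0 cv v0 vC)).
- move=> l; exact: cvg_hemi_integral r0 cv v0 vC _.
- move=> n; have /andP[h1 h2] := u21 n.
  by rewrite -[leLHS]invrK lef_pV2 ?posrE ?subr_gt0//; lra.
apply/cvgrVy; first by apply: nearW => n; rewrite subr_gt0.
by rewrite -(subrr (1 : R)); apply: cvgB => //; exact: cvg_cst.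
Qed.

(** * From the origin to an arbitrary centre, and from nonnegative to signed functions *)

Lemma continuous_shift_comp (R : realType) (n : nat) (g : 'rV[R]_n -> R) (x : 'rV[R]_n) :
  continuous g -> continuous (fun y : 'rV[R]_n => g (x + y)).
Proof.
move=> cg y; apply: continuous_comp; last exact: cg.
by apply: (@continuousD _ _ _ (cst x) id); [exact: cst_continuous|exact: cvg_id].
Qed.

Lemma continuous_reflect_comp (R : realType) (n : nat) (g : 'rV[R]_n -> R) (x : 'rV[R]_n) :
  continuous g -> continuous (fun y : 'rV[R]_n => g (x - y)).
Proof.
move=> cg y; apply: continuous_comp; last exact: cg.
by apply: (@continuousB _ _ _ (cst x) id); [exact: cst_continuous|exact: cvg_id].
Qed.

Lemma A_kernelN (R : realType) (n : nat) (s r : R) (y : 'rV[R]_n) :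
  A_kernel s r (- y) = A_kernel s r y.
Proof. by rewrite /A_kernel -scaleN1r enormZ normrN1 mul1r. Qed.

Lemma measurable_A_kernel (R : realType) (n : nat) (s r : R) :
  measurable_fun setT (fun t : tuples R n => A_kernel s r (row_of_tuple t)).
Proof.
have me := @measurable_enorm R n.
apply: measurable_fun_ifT => //; first exact: measurable_fun_ltr.
apply: measurable_funM => //; apply: measurable_funM => //; apply: measurable_funV.
apply: measurable_funM; last exact: measurable_funX.
apply: measurableT_comp (measurable_powR s) _.
by apply: measurable_funB => //; exact: measurable_funX.
Qed.

Lemma A_kernel_ge0 (R : realType) (n : nat) (s r : R) (y : 'rV[R]_n) :
  0 < s < 1 -> 0 <= A_kernel s r y.
Proof.
move=> s01; rewrite /A_kernel; case: ifP => // _.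
by rewrite mulr_ge0 ?c_ns_ge0// divr_ge0 ?mulr_ge0 ?powR_ge0 ?exprn_ge0 ?enorm_ge0.
Qed.

(** The kernel is even and scaling by -1 preserves the measure. This reconciles the convolution,
    which evaluates at x - y, with the hemispheres, which are parametrised as x + y. *)
Lemma integral_A_kernel_reflect (R : realType) (n : nat) (g : 'rV[R]_n -> R)
    (x : 'rV[R]_n) (s r : R) :
  continuous g -> (forall y, 0 <= g y) -> 0 < s < 1 ->
  (\int[lebesgue_tuple R n]_t (A_kernel s r (row_of_tuple t) * g (x - row_of_tuple t))%:E =
   \int[lebesgue_tuple R n]_t (A_kernel s r (row_of_tuple t) * g (x + row_of_tuple t))%:E)%E.
Proof.
move=> cg g0 s01.
have N10 : (-1 : R) != 0 by rewrite oppr_eq0 oner_eq0.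
have cg' := continuous_reflect_comp (x := x) cg.
rewrite (ge0_integral_tuple_scale N10
  (F := fun t => (A_kernel s r (row_of_tuple t) * g (x - row_of_tuple t))%:E)); last 2 first.
- apply/measurable_EFinP; apply: measurable_funM; first exact: measurable_A_kernel.
  exact: measurable_continuous_row cg'.
- by move=> t; rewrite lee_fin mulr_ge0// A_kernel_ge0.
rewrite normrN1 expr1n mul1e; apply: eq_integral => t _.
by rewrite row_of_tuple_scale scaleN1r opprK A_kernelN.
Qed.

Definition kernel_mean (R : realType) (n : nat) (s r : R) (g : 'rV[R]_n -> R) (x : 'rV[R]_n) : R :=
  (\int[lebesgue_tuple R n]_t (A_kernel s r (row_of_tuple t) * g (x - row_of_tuple t)))%R.

Definition hemisphere_integral (R : realType) (m : nat) (g : 'rV[R]_m.+1 -> R)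
    (x : 'rV[R]_m.+1) (r sgn : R) : R :=
  (\int[lebesgue_tuple R m]_(t in @row_of_tuple R m @^-1` [set y | (enorm y < r)%R])
     (g (@hemisphere R m.+1 x r sgn (row_of_tuple t)) *
      area_density (@hemisphere R m.+1 x r sgn) (row_of_tuple t)))%R.

Lemma hemisphere_integralE (R : realType) (m : nat) (g : 'rV[R]_m.+1 -> R)
    (x : 'rV[R]_m.+1) (r sgn : R) : sgn ^+ 2 = 1 ->
  hemisphere_integral g x r sgn = (\int[lebesgue_tuple R m]_t
     (g (@hemisphere R m.+1 x r sgn (row_of_tuple t)) * (r * inv_height r (row_of_tuple t))))%R.
Proof.
move=> s1; rewrite /hemisphere_integral Rintegral_mkcond; apply: eq_Rintegral => t _.
rewrite patchE /inv_height; case: ifPn => tr.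
  rewrite inE/= in tr.
  by rewrite tr area_density_hemisphere.
rewrite notin_setE /= in tr; case: ifPn => [/tr//|_].
by rewrite !mulr0.
Qed.

Lemma integrable_hemisphere (R : realType) (m : nat) (g : 'rV[R]_m.+1 -> R)
    (x : 'rV[R]_m.+1) (r sgn C : R) : 0 < r -> continuous g -> (forall y, `|g y| <= C) ->
  (lebesgue_tuple R m).-integrable setT (EFin \o (fun t =>
     g (@hemisphere R m.+1 x r sgn (row_of_tuple t)) * (r * inv_height r (row_of_tuple t)))).
Proof.
move=> r0 cg gC.
have mih := @measurable_inv_height R m r.
have mg : measurable_fun setT
    (fun t : tuples R m => g (@hemisphere R m.+1 x r sgn (row_of_tuple t))).
  have cg' := continuous_shift_comp (x := x) cg.
  rewrite /hemisphere; under eq_fun do rewrite -row_of_tuple_rcons.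
  apply: (measurableT_comp (measurable_continuous_row cg')).
  apply: (measurableT_comp (@measurable_tuple_rcons R m)).
  apply: measurable_fun_pair => //; apply: measurable_funM => //.
  apply: measurable_fun_sqrt; apply: measurable_funB => //.
  by apply: measurable_funX; exact: measurable_enorm.
apply: le_integrable (integrableZl _ (C * r) (integrable_inv_height m r0)) => //.
  by apply/measurable_EFinP; apply: measurable_funM => //; exact: measurable_funM.
move=> t _; rewrite /= lee_fin !normrM (ger0_norm (inv_height_ge0 _ _)) -mulrA.
rewrite ler_pM// ?(le_trans (gC _)) ?ler_norm// mulr_ge0 ?inv_height_ge0//.
Qed.

Lemma hemi_integral_hemisphere (R : realType) (m : nat) (g : 'rV[R]_m.+1 -> R)
    (x : 'rV[R]_m.+1) (r C : R) :
  0 < r -> continuous g -> (forall y, 0 <= g y) -> (forall y, g y <= C) ->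
  r * hemi_integral (fun y => g (x + y)) r 1 =
  hemisphere_integral g x r 1 + hemisphere_integral g x r (-1).
Proof.
move=> r0 cg g0 gC; rewrite !hemisphere_integralE ?sqrrN ?expr1n//.
have gC' y : `|g y| <= C by rewrite ger0_norm.
have ig sgn := integrable_hemisphere x sgn r0 cg gC'.
rewrite -RintegralD// /hemi_integral -RintegralZl//; last first.
  exact: (integrable_hemi_sum r0 (continuous_shift_comp (x := x) cg)
    (fun y => g0 (x + y)) (fun y => gC (x + y))).
apply: eq_Rintegral => t _; rewrite /hemi_sum /hemisphere !scale1r mul1r mulN1r.
by ring.
Qed.

(** Finiteness is read off [integral_A_kernel], whose right side is a real number. *)
Lemma integrable_kernel_mean (R : realType) (m : nat) (g : 'rV[R]_m.+1 -> R)
    (x : 'rV[R]_m.+1) (r C s : R) :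
  0 < r -> continuous g -> (forall y, 0 <= g y) -> (forall y, g y <= C) ->
  2^-1 <= s < 1 ->
  (lebesgue_tuple R m.+1).-integrable setT
    (EFin \o (fun t => A_kernel s r (row_of_tuple t) * g (x - row_of_tuple t))).
Proof.
move=> r0 cg g0 gC s21.
have s01 : 0 < s < 1 by case/andP: s21 => h ->; rewrite (lt_le_trans _ h).
apply/integrableP; split.
  apply/measurable_EFinP; apply: measurable_funM; first exact: measurable_A_kernel.
  exact: measurable_continuous_row (continuous_reflect_comp (x := x) cg).
under eq_integral do rewrite /= ger0_norm ?mulr_ge0 ?A_kernel_ge0//.
rewrite integral_A_kernel_reflect//.
by rewrite (integral_A_kernel r0 (continuous_shift_comp (x := x) cg)
  (fun y => g0 (x + y)) (fun y => gC (x + y)) s21) ltry.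
Qed.

Lemma cvg_kernel_mean_ge0 (R : realType) (m : nat) (g : 'rV[R]_m.+1 -> R)
    (x : 'rV[R]_m.+1) (r C : R) (u : nat -> R) :
  0 < r -> continuous g -> (forall y, 0 <= g y) -> (forall y, g y <= C) ->
  (forall n, 2^-1 <= u n < 1) -> u n @[n --> \oo] --> (1 : R) ->
  kernel_mean (u n) r g x @[n --> \oo] -->
  (sphere_area R m.+1 * r ^+ m)^-1 *
    (hemisphere_integral g x r 1 + hemisphere_integral g x r (-1)).
Proof.
move=> r0 cg g0 gC u21 uc; rewrite -(hemi_integral_hemisphere x r0 cg g0 gC).
have s01 n : 0 < u n < 1 by case/andP: (u21 n) => h ->; rewrite (lt_le_trans _ h).
under eq_fun do rewrite /kernel_mean /Rintegral integral_A_kernel_reflect//.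
exact: (cvg_A_kernel_seq r0 (continuous_shift_comp (x := x) cg)
  (fun y => g0 (x + y)) (fun y => gC (x + y)) u21 uc).
Qed.

(** Write g = (g + C) - C: both terms are continuous, bounded and nonnegative, and the two sides are
    linear thanks to the integrability lemmas. *)
Lemma cvg_kernel_mean (R : realType) (m : nat) (g : 'rV[R]_m.+1 -> R)
    (x : 'rV[R]_m.+1) (r C : R) :
  0 < r -> continuous g -> (forall y, `|g y| <= C) ->
  kernel_mean s r g x @[s --> (1 : R)^'-] -->
  (sphere_area R m.+1 * r ^+ m)^-1 *
    (hemisphere_integral g x r 1 + hemisphere_integral g x r (-1)).
Proof.
move=> r0 cg gC; apply/cvg_at_leftP => u [u1 uc].
(* The one-sided limit has been reduced to sequences, as dominated convergence requires. Dropping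
   the first N terms makes s >= 1/2 hold at every index. *)
have [N _ Nu] : \forall n \near \oo, 2^-1 <= u n.
  by apply: (cvgr_ge _ uc); rewrite invf_lt1 ?ltr1n.
rewrite -(cvg_shiftn N).
have u21 n : 2^-1 <= u (n + N)%N < 1 by rewrite u1 Nu//= leq_addl.
have {uc Nu} uc : u (n + N)%N @[n --> \oo] --> (1 : R) by rewrite (cvg_shiftn N u).
pose gp y := g y + C; pose gc (_ : 'rV[R]_m.+1) := C.
have C0 : 0 <= C by apply: le_trans (gC 0).
have cc : continuous gc by exact: cst_continuous.
have cp : continuous gp.
  by move=> y; apply: (@continuousD _ _ _ g (cst C)); [exact: cg|exact: cst_continuous].
have gp0 y : 0 <= gp y by have := gC y; rewrite ler_norml /gp => /andP[]; lra.
have gpC y : gp y <= C + C by have := gC y; rewrite ler_norml /gp => /andP[]; lra.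
have gpC' y : `|gp y| <= C + C by rewrite ger0_norm.
have gc0 y : 0 <= gc y by [].
have gcC y : gc y <= C by [].
have gcC' y : `|gc y| <= C by rewrite ger0_norm.
have E n : kernel_mean (u (n + N)%N) r g x =
    kernel_mean (u (n + N)%N) r gp x - kernel_mean (u (n + N)%N) r gc x.
  rewrite /kernel_mean -RintegralB//.
  - by apply: eq_Rintegral => t _; rewrite -mulrBr /gp /gc addrK.
  - exact: integrable_kernel_mean r0 cp gp0 gpC (u21 n).
  - exact: integrable_kernel_mean r0 cc gc0 gcC (u21 n).
have H sgn : sgn ^+ 2 = 1 -> hemisphere_integral g x r sgn =
    hemisphere_integral gp x r sgn - hemisphere_integral gc x r sgn.
  move=> s1; rewrite !hemisphere_integralE// -RintegralB//.
  - by apply: eq_Rintegral => t _; rewrite -mulrBl /gp /gc addrK.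
  - exact: integrable_hemisphere r0 cp gpC'.
  - exact: integrable_hemisphere r0 cc gcC'.
under eq_fun do rewrite E.
rewrite !H ?sqrrN ?expr1n// addrACA -opprD mulrBr.
by apply: cvgB; [exact: cvg_kernel_mean_ge0 r0 cp gp0 gpC u21 uc
                |exact: cvg_kernel_mean_ge0 r0 cc gc0 gcC u21 uc].
Qed.

(** * Complex values and conclusion *)

(** The norm of [R[i]^o] takes values in [R[i]] itself, so the radius of a ball is a complex number;
    being positive, it is real. *)
Lemma cvg_complex (R : realType) (T : Type) (F : set_system T) (a b : T -> R) (la lb : R) :
  Filter F -> a t @[t --> F] --> la -> b t @[t --> F] --> lb ->
  (a t +i* b t : R[i]^o) @[t --> F] --> (la +i* lb : R[i]^o).
Proof.
move=> FF ca cb; apply/cvgrPdist_lt => e e0.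
have [e1 e10 eE] : exists2 e1 : R, 0 < e1 & e = e1%:C.
  by case: e e0 => p q; rewrite ltcE/= => /andP[/eqP q0 p0]; exists p; rewrite // q0.
have e2 : 0 < e1 / 2 by rewrite divr_gt0.
(* Each component is kept within e1 / 2, so the squared modulus is at most e1^2 / 2 < e1^2. *)
near=> t; rewrite eE normc_def ltcR/= ltr_sqrtl ?(ltW e10)// e10/=.
have : `|la - a t| < e1 / 2 by near: t; exact: (cvgrPdist_lt _ _).1 ca _ e2.
have : `|lb - b t| < e1 / 2 by near: t; exact: (cvgrPdist_lt _ _).1 cb _ e2.
rewrite !ltr_norml => /andP[? ?] /andP[? ?].
have : (la - a t) ^+ 2 <= (e1 / 2) ^+ 2 by rewrite -subr_ge0 subr_sqr mulr_ge0//; lra.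
have : (lb - b t) ^+ 2 <= (e1 / 2) ^+ 2 by rewrite -subr_ge0 subr_sqr mulr_ge0//; lra.
by have : 0 < e1 ^+ 2 by [rewrite exprn_gt0]; lra.
Unshelve. all: by end_near. Qed.

Lemma schwartz_real_continuous (R : realType) (n : nat) (f : 'rV[R]_n -> R) :
  schwartz_real f -> continuous f.
Proof. by move=> /(_ [::]) []. Qed.

Lemma schwartz_real_bounded (R : realType) (n : nat) (f : 'rV[R]_n -> R) :
  schwartz_real f -> exists C : R, forall y, `|f y| <= C.
Proof.
move=> /(_ [::]) [_ _ /(_ (fun=> 0%N)) [C fC]]; exists C => y.
by have := fC y; rewrite big1 ?mul1r// => i _; rewrite expr0.
Qed.

Lemma nonlocal_meanE (R : realType) (n : nat) (s r : R) (u : 'rV[R]_n -> R[i]) (x : 'rV[R]_n) :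
  nonlocal_mean s r u x =
  kernel_mean s r (fun y => complex.Re (u y)) x +i* kernel_mean s r (fun y => complex.Im (u y)) x.
Proof.
rewrite /nonlocal_mean /integral_rV preimage_setT; congr (_ +i* _).
  by apply: eq_Rintegral => t _; case: (u _) => p q /=; rewrite mul0r subr0.
by apply: eq_Rintegral => t _; case: (u _) => p q /=; rewrite mul0r addr0.
Qed.

Lemma surface_integral_hemisphere (R : realType) (m : nat) (u : 'rV[R]_m.+1 -> R[i])
    (x : 'rV[R]_m.+1) (r sgn : R) :
  @surface_integral R m.+1 [set y | enorm y < r] (@hemisphere R m.+1 x r sgn) u =
  hemisphere_integral (fun y => complex.Re (u y)) x r sgn +i*
  hemisphere_integral (fun y => complex.Im (u y)) x r sgn.
Proof.
rewrite /surface_integral /integral_rV /hemisphere_integral; congr (_ +i* _).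
  by apply: eq_Rintegral => t _; case: (u _) => p q /=; rewrite mulr0 subr0.
by apply: eq_Rintegral => t _; case: (u _) => p q /=; rewrite mulr0 add0r.
Qed.

Theorem proposition15p4 (R : realType) (n : nat) (hn : (2 <= n)%N)
    (r : R) (hr : 0 < r) (u : 'rV[R]_n -> R[i]) (hu : schwartz u)
    (x : 'rV[R]_n) :
  nonlocal_mean s r u x @[s --> (1 : R)^'-] --> (spherical_mean r u x : R[i]^o).
Proof.
(* Writing the dimension as [m.+1] singles out the last coordinate, of which the hemispheres are
   graphs, and lets [n.-1] compute to [m]. *)
case: n hn u hu x => // m _ u [hRe hIm] x.
have [C1 bRe] := schwartz_real_bounded hRe.
have [C2 bIm] := schwartz_real_bounded hIm.
rewrite /spherical_mean /sphere_integral !surface_integral_hemisphere /=.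
under eq_fun do rewrite nonlocal_meanE.
have cRe := cvg_kernel_mean (x := x) hr (schwartz_real_continuous hRe) bRe.
have cIm := cvg_kernel_mean (x := x) hr (schwartz_real_continuous hIm) bIm.
have := cvg_complex _ cRe cIm.
rewrite (_ : _ * _ = ((sphere_area R m.+1 * r ^+ m)^-1 *
    (hemisphere_integral (fun y => complex.Re (u y)) x r 1 +
     hemisphere_integral (fun y => complex.Re (u y)) x r (-1))) +i*
  ((sphere_area R m.+1 * r ^+ m)^-1 *
    (hemisphere_integral (fun y => complex.Im (u y)) x r 1 +
     hemisphere_integral (fun y => complex.Im (u y)) x r (-1)))).
  by apply.
by apply/eqP; rewrite eq_complex /= !mul0r subr0 addr0 !eqxx.
Qed.
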